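(* Let $(X,w,\mu)$ be a weighted graph and let $d$ be an intrinsic pseudo metric on it. Suppose that the weighted degree function $\mathrm{Deg}$ is bounded on the combinatorial neighborhood $n(B_r(x_0))$ of each distance ball $B_r(x_0)$, $x_0\in X$, $r\ge 0$. Then $$D(Q)=D(Q^{\max}),$$ $$D(L)=\{u\in L^2(X,\mu)\cap F\mid \Delta u\in L^2(X,\mu)\}.$$ In particular, if additionally $\Delta C_c(X)\subseteq L^2(X,\mu)$, then $L_c=\Delta|_{C_c(X)}$ is essentially self-adjoint on $L^2(X,\mu)$.
   Context: All functions are real valued. A weighted graph $(X,w,\mu)$ consists of a countably infinite discrete set $X$, a function $\mu:X\to(0,\infty)$ (viewed as a measure on $X$), and a symmetric function $w:X\times X\to[0,\infty)$ with $w(x,x)=0$ and $\sum_{y\in X}w(x,y)<\infty$ for all $x\in X$. Write $x\sim y$ if $w(x,y)>0$. All weighted graphs are assumed connected: any two distinct $x,y\in X$ are joined by a finite sequence $x=x_0\sim x_1\sim\dots\sim x_n=y$. The weighted degree is $\mathrm{Deg}(x)=\frac1{\mu(x)}\sum_{y\in X}w(x,y)$. A pseudo metric is a map $d:X\times X\to[0,\infty)$ that is symmetric, vanishes on the diagonal and satisfies the triangle inequality; it is intrinsic if $\frac1{\mu(x)}\sum_{y\in X}w(x,y)d(x,y)^2\le 1$ for all $x\in X$. Distance balls are $B_r(x_0)=\{x\in X\mid d(x,x_0)\le r\}$. For $K\subseteq X$ the combinatorial neighborhood is $n(K)=K\cup\{x\in X\mid x\sim y\text{ for some }y\in K\}$.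 $C(X)$ is the set of all functions $X\to\mathbb R$, $C_c(X)$ the finitely supported ones, and $L^2(X,\mu)$ has norm $\|u\|=(\sum_{x}u(x)^2\mu(x))^{1/2}$. For $f\in C(X)$ let $\widetilde Q(f)=\frac12\sum_{x,y\in X}w(x,y)(f(x)-f(y))^2\in[0,\infty]$ (extended to a bilinear form by polarization on $\{\widetilde Q<\infty\}$) and $\|f\|_{\widetilde Q}=(\widetilde Q(f)+\|f\|^2)^{1/2}$. Set $D(Q^{\max})=\{f\in L^2(X,\mu)\mid\widetilde Q(f)<\infty\}$ and let $D(Q)$ be the closure of $C_c(X)$ with respect to $\|\cdot\|_{\widetilde Q}$ (within $D(Q^{\max})$); $Q^{\max}$ and $Q$ are the restrictions of $\widetilde Q$ to these domains. $L$, with domain $D(L)$, is the non-negative self-adjoint operator on $L^2(X,\mu)$ associated with the closed form $(Q,D(Q))$. The formal Laplacian is $(\Delta f)(x)=\frac1{\mu(x)}\sum_{y\in X}w(x,y)(f(x)-f(y))$ with domain $F=\{f\in C(X)\mid\sum_{y\in X}w(x,y)|f(y)|<\infty\text{ for all }x\in X\}$. *)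

(* Defs.v *)
From mathcomp Require Import all_boot all_order all_algebra.
From mathcomp Require Import boolp classical_sets functions cardinality.
From mathcomp Require Import reals ereal numfun esum.

Set Implicit Arguments.
Unset Strict Implicit.
Unset Printing Implicit Defensive.

Import Order.TTheory GRing.Theory Num.Theory.

Local Open Scope classical_set_scope.
Local Open Scope ring_scope.

(* Unconditional sum of an absolutely summable real family, as the difference
   of the sums of its positive and negative parts.  The value is meaningful only
   for summable families; sums of nonnegative families that may diverge are
   always taken in [\bar R] with [\esum]. *)
Definition rsum (R : realType) (T : choiceType) (f : T -> R) : R :=
  fine (\esum_(i in [set: T]) (EFin \o f)^\+%E i)
  - fine (\esum_(i in [set: T]) (EFin \o f)^\-%E i).

Record weighted_graph (R : realType) (X : countType) := WeightedGraph {
  edge_weight : X -> X -> R;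
  vertex_measure : X -> R;
  vertices_infinite : infinite_set [set: X];
  vertex_measure_gt0 : forall x, 0 < vertex_measure x;
  edge_weight_ge0 : forall x y, 0 <= edge_weight x y;
  edge_weight_sym : forall x y, edge_weight x y = edge_weight y x;
  edge_weight_diag : forall x, edge_weight x x = 0;
  edge_weight_summable :
    forall x, (\esum_(y in [set: X]) (edge_weight x y)%:E < +oo)%E;
  weighted_graph_connected : forall x y, x != y ->
    exists p : seq X, path (fun a b => 0 < edge_weight a b) x p /\ last x p = y
}.

Definition adj (R : realType) (X : countType) (G : weighted_graph R X) (x y : X)
    : Prop :=
  0 < edge_weight G x y.

Definition Deg (R : realType) (X : countType) (G : weighted_graph R X) (x : X)
    : \bar R :=
  (((vertex_measure G x)^-1)%:E
    * (\esum_(y in [set: X]) (edge_weight G x y)%:E))%E.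

Record pseudo_metric (R : realType) (X : Type) (d : X -> X -> R) : Prop := {
  pseudo_metric_ge0 : forall x y, 0 <= d x y;
  pseudo_metric_refl : forall x, d x x = 0;
  pseudo_metric_sym : forall x y, d x y = d y x;
  pseudo_metric_triangle : forall x y z, d x z <= d x y + d y z
}.

Definition intrinsic (R : realType) (X : countType) (G : weighted_graph R X)
    (d : X -> X -> R) : Prop :=
  forall x, (((vertex_measure G x)^-1)%:E
    * (\esum_(y in [set: X]) (edge_weight G x y * d x y ^+ 2)%:E) <= 1)%E.

Definition dist_ball (R : realType) (X : Type) (d : X -> X -> R) (r : R) (x0 : X)
    : set X :=
  [set x | d x x0 <= r].

Definition comb_nbhd (R : realType) (X : countType) (G : weighted_graph R X)
    (K : set X) : set X :=
  K `|` [set x | exists2 y, K y & adj G x y].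

Definition Cc (R : realType) (X : countType) : set (X -> R) :=
  [set f | finite_set [set x | f x != 0]].
Arguments Cc {R X}.

(* Since the measure charges every point, elements of L^2 are genuine functions
   and no quotient is needed. *)
Definition sqnorm2 (R : realType) (X : countType) (G : weighted_graph R X)
    (u : X -> R) : \bar R :=
  (\esum_(x in [set: X]) (u x ^+ 2 * vertex_measure G x)%:E)%E.

Definition norm2 (R : realType) (X : countType) (G : weighted_graph R X)
    (u : X -> R) : \bar R :=
  sqrte (sqnorm2 G u).

Definition L2 (R : realType) (X : countType) (G : weighted_graph R X)
    : set (X -> R) :=
  [set u | (norm2 G u < +oo)%E].

Definition inner2 (R : realType) (X : countType) (G : weighted_graph R X)
    (u v : X -> R) : R :=
  rsum (fun x => u x * v x * vertex_measure G x).

Definition Qtilde (R : realType) (X : countType) (G : weighted_graph R X)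
    (f : X -> R) : \bar R :=
  ((2^-1)%:E * (\esum_(p in [set: X * X])
     (edge_weight G p.1 p.2 * (f p.1 - f p.2) ^+ 2)%:E))%E.

(* Polarization; meaningful when both arguments have finite energy. *)
Definition Qtilde_bilin (R : realType) (X : countType) (G : weighted_graph R X)
    (f g : X -> R) : R :=
  (fine (Qtilde G (f \+ g)) - fine (Qtilde G (f \- g))) / 4.

Definition normQ (R : realType) (X : countType) (G : weighted_graph R X)
    (f : X -> R) : \bar R :=
  sqrte (Qtilde G f + sqnorm2 G f)%E.

Definition DQmax (R : realType) (X : countType) (G : weighted_graph R X)
    : set (X -> R) :=
  [set f | L2 G f /\ (Qtilde G f < +oo)%E].

Definition DQ (R : realType) (X : countType) (G : weighted_graph R X)
    : set (X -> R) :=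
  [set f | DQmax G f /\
    forall e : R, 0 < e -> exists2 g, Cc g & (normQ G (f \- g)%R < e%:E)%E].

Definition domF (R : realType) (X : countType) (G : weighted_graph R X)
    : set (X -> R) :=
  [set f | forall x,
    (\esum_(y in [set: X]) (edge_weight G x y * `|f y|)%:E < +oo)%E].

Definition Lap (R : realType) (X : countType) (G : weighted_graph R X)
    (f : X -> R) : X -> R :=
  fun x => (vertex_measure G x)^-1
           * rsum (fun y => edge_weight G x y * (f x - f y)).

(* Unbounded operators on L^2 are represented by their graphs. *)
Definition op_graph (R : realType) (X : countType) := set ((X -> R) * (X -> R)).

Definition op_dom (R : realType) (X : countType) (T : op_graph R X)
    : set (X -> R) :=
  [set u | exists f, T (u, f)].

Definition densely_defined (R : realType) (X : countType)
    (G : weighted_graph R X) (T : op_graph R X) : Prop :=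
  forall u, L2 G u -> forall e : R, 0 < e ->
    exists2 v, op_dom T v & (norm2 G (u \- v)%R < e%:E)%E.

Definition op_adjoint (R : realType) (X : countType) (G : weighted_graph R X)
    (T : op_graph R X) : op_graph R X :=
  [set vg | [/\ L2 G vg.1, L2 G vg.2 &
    forall u f, T (u, f) -> inner2 G f vg.1 = inner2 G u vg.2]].

Definition op_closure (R : realType) (X : countType) (G : weighted_graph R X)
    (T : op_graph R X) : op_graph R X :=
  [set uf | [/\ L2 G uf.1, L2 G uf.2 &
    forall e : R, 0 < e -> exists v g, [/\ T (v, g),
      (norm2 G (uf.1 \- v)%R < e%:E)%E & (norm2 G (uf.2 \- g)%R < e%:E)%E]]].

(* Density of the domain makes the adjoint, hence [T] itself, single-valued;
   linearity of [T] also follows from [T = op_adjoint G T]. *)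
Definition self_adjoint (R : realType) (X : countType) (G : weighted_graph R X)
    (T : op_graph R X) : Prop :=
  densely_defined G T /\ T = op_adjoint G T.

Definition essentially_self_adjoint (R : realType) (X : countType)
    (G : weighted_graph R X) (T : op_graph R X) : Prop :=
  T `<=` L2 G `*` L2 G /\ self_adjoint G (op_closure G T).

(* The operator associated with the closed form (Q, D(Q)) by the representation
   theorem: u is in D(L) with Lu = f iff u is in D(Q), f is in L^2, and
   Q(u, v) = <f, v> for all v in D(Q). *)
Definition opL (R : realType) (X : countType) (G : weighted_graph R X)
    : op_graph R X :=
  [set uf | [/\ DQ G uf.1, L2 G uf.2 &
    forall v, DQ G v -> Qtilde_bilin G uf.1 v = inner2 G uf.2 v]].

Definition opLc (R : realType) (X : countType) (G : weighted_graph R X)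
    : op_graph R X :=
  [set uf | Cc uf.1 /\ uf.2 = Lap G uf.1].

(* Main.v *)
Require Import Defs.
From mathcomp Require Import all_boot all_order all_algebra.
From mathcomp Require Import boolp classical_sets functions cardinality.
From mathcomp Require Import reals ereal numfun esum fsbigop.
From mathcomp Require Import ring lra.

Set Implicit Arguments.
Unset Strict Implicit.
Unset Printing Implicit Defensive.

Import Order.TTheory GRing.Theory Num.Theory.

Local Open Scope classical_set_scope.
Local Open Scope ring_scope.

(* Let [c_n] be the cutoff function equal to 1 on the ball of radius n around a
   point and to 0 off the ball of radius 2n, with Lipschitz constant 1/n.  Since
   d is intrinsic, the sum of w(x,y) (c_n(x) - c_n(y))^2 u(x)^2 is at most
   |u|^2 / n^2.  Hence c_n f tends to f in the form norm for f in D(Q^max), and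
   c_n f is in D(Q) because Deg is bounded on its support.
   If u and Delta u are in L^2, boundedness of Deg on the neighborhoods of balls
   makes Green's formula for the pair (u, c_n^2 u) absolutely convergent; it
   bounds the energy of c_n u uniformly in n, so u has finite energy.  By density
   Q(u, v) = <Delta u, v> for all v in D(Q), and Delta is symmetric and
   nonnegative on its maximal domain.
   Consequently a function z orthogonal to (Delta + 1) C_c satisfies
   Delta z = - z weakly, so -|z|^2 = Q(z) >= 0 and z = 0.  The density of
   (Delta + 1) C_c and |(Delta + 1) z|^2 >= |z|^2 + |Delta z|^2 give that C_c is
   a core of the maximal operator, which is its own adjoint. *)

(** * Sums of absolutely summable families *)

Section RealSums.
Variables (R : realType).
Implicit Types (T : choiceType).

(** Absolute summability, the condition under which [rsum] is meaningful and linear. *)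
Definition summ T (f : T -> R) : Prop :=
  (\esum_(i in [set: T]) (`|f i|)%:E < +oo)%E.

Lemma sum_le_esum T (f : T -> R) (s : seq T) : (forall i, 0 <= f i) -> uniq s ->
  ((\sum_(i <- s) f i)%:E <= \esum_(i in [set: T]) (f i)%:E)%E.
Proof.
move=> f0 us; apply: esum_ge; exists [set` s].
  by split => //; exact: finite_seq.
by rewrite -fsbig_seq// sumEFin.
Qed.

Lemma esum_le_bound T (f : T -> R) (M : \bar R) :
  (forall s : seq T, uniq s -> (\sum_(i <- s) f i)%:E <= M)%E ->
  (\esum_(i in [set: T]) (f i)%:E <= M)%E.
Proof.
move=> H; apply: ge_ereal_sup => /= _ [A [finA _]] <-.
by rewrite fsbig_finite//= sumEFin H.
Qed.

Lemma summ_bound T (f : T -> R) (M : R) :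
  (forall s : seq T, uniq s -> \sum_(i <- s) `|f i| <= M) -> summ f.
Proof.
move=> H; apply: (@le_lt_trans _ _ M%:E); last exact: ltry.
by apply: esum_le_bound => s us; rewrite lee_fin H.
Qed.

Lemma ge0_rsumE T (f : T -> R) : (forall i, 0 <= f i) ->
  rsum f = fine (\esum_(i in [set: T]) (f i)%:E).
Proof.
move=> f0; rewrite /rsum [X in _ - fine X](_ : _ = 0%E) ?subr0.
  congr fine; apply: eq_esum => i _.
  by rewrite funeposE/=; apply/max_idPl; rewrite lee_fin.
rewrite esum1// => i _; rewrite funenegE/=.
by apply/max_idPr; rewrite lee_fin oppr_le0.
Qed.

Lemma ge0_esum_rsum T (f : T -> R) : (forall i, 0 <= f i) -> summ f ->
  (\esum_(i in [set: T]) (f i)%:E)%E = (rsum f)%:E.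
Proof.
move=> f0 sf; rewrite ge0_rsumE// fineK// ge0_fin_numE; last first.
  by apply: esum_ge0 => i _; rewrite lee_fin.
apply: le_lt_trans sf; apply: le_esum => i _.
by rewrite lee_fin ger0_norm.
Qed.

Lemma ge0_summ T (f : T -> R) : (forall i, 0 <= f i) ->
  summ f <-> (\esum_(i in [set: T]) (f i)%:E < +oo)%E.
Proof.
move=> f0; rewrite /summ.
rewrite (@eq_esum _ _ _ (fun i => (`|f i|)%:E) (fun i => (f i)%:E))//.
by move=> i _; rewrite ger0_norm.
Qed.

Lemma rsum_ge0 T (f : T -> R) : (forall i, 0 <= f i) -> 0 <= rsum f.
Proof.
move=> f0; rewrite ge0_rsumE//; apply/fine_ge0/esum_ge0 => i _.
by rewrite lee_fin.
Qed.

Lemma eq_rsum T (f g : T -> R) : (forall i, f i = g i) -> rsum f = rsum g.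
Proof. by move=> /funext ->. Qed.

Lemma eq_summ T (f g : T -> R) : (forall i, f i = g i) -> summ f -> summ g.
Proof. by move=> /funext ->. Qed.

Lemma summ_le T (f g : T -> R) : (forall i, `|f i| <= g i) -> summ g -> summ f.
Proof.
move=> fg; apply: le_lt_trans; apply: le_esum => i _; rewrite lee_fin.
exact: le_trans (fg i) (ler_norm _).
Qed.

Lemma summD T (f g : T -> R) : summ f -> summ g -> summ (fun i => f i + g i).
Proof.
move=> sf sg; apply: le_lt_trans (lte_add_pinfty sf sg).
rewrite -esumD; do ?by move=> i _; rewrite lee_fin.
by apply: le_esum => i _; rewrite lee_fin ler_normD.
Qed.

Lemma sum_norm_le T (f : T -> R) : summ f ->
  exists M, 0 <= M /\ forall s : seq T, uniq s -> \sum_(i <- s) `|f i| <= M.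
Proof.
move=> sf; exists (fine (\esum_(i in [set: T]) (`|f i|)%:E)); split.
  by apply/fine_ge0/esum_ge0 => i _; rewrite lee_fin.
move=> s us; rewrite -lee_fin fineK; first exact: sum_le_esum.
by rewrite ge0_fin_numE// esum_ge0// => i _; rewrite lee_fin.
Qed.

Lemma summZ T (f : T -> R) c : summ f -> summ (fun i => c * f i).
Proof.
move=> /sum_norm_le[M [M0 H]]; apply: (@summ_bound _ _ (`|c| * M)) => s us.
under eq_bigr do rewrite normrM.
by rewrite -mulr_sumr ler_wpM2l// H.
Qed.

Lemma summN T (f : T -> R) : summ f -> summ (fun i => - f i).
Proof. by move=> /(@summZ _ _ (-1)); apply: eq_summ => i; rewrite mulN1r. Qed.

Lemma summB T (f g : T -> R) : summ f -> summ g -> summ (fun i => f i - g i).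
Proof. by move=> sf /summN; exact: summD. Qed.

Lemma summ_norm T (f : T -> R) : summ f -> summ (fun i => `|f i|).
Proof. by move=> sf; apply/ge0_summ. Qed.

(** * Linearity of sums, by splitting into positive and negative parts *)

Let pos T (f : T -> R) i := Num.max (f i) 0.
Let neg T (f : T -> R) i := Num.max (- f i) 0.

Let pos_ge0 T (f : T -> R) i : 0 <= pos f i.
Proof. by rewrite /pos le_max lexx orbT. Qed.

Let neg_ge0 T (f : T -> R) i : 0 <= neg f i.
Proof. by rewrite /neg le_max lexx orbT. Qed.

Let posneg T (f : T -> R) i : f i = pos f i - neg f i.
Proof. by rewrite /pos /neg; case: leP => ?; case: leP => ?; lra. Qed.

Let posnegD T (f : T -> R) i : `|f i| = pos f i + neg f i.
Proof.
rewrite /pos /neg; case: (ger0P (f i)) => ?.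
  by case: (leP (f i) 0) => ?; case: (leP (- f i) 0) => ?; lra.
by case: (leP (f i) 0) => ?; case: (leP (- f i) 0) => ?; lra.
Qed.

Let summ_pos T (f : T -> R) : summ f -> summ (pos f).
Proof.
move=> /summ_norm; apply: summ_le => i.
by rewrite ger0_norm// posnegD lerDl.
Qed.

Let summ_neg T (f : T -> R) : summ f -> summ (neg f).
Proof.
move=> /summ_norm; apply: summ_le => i.
by rewrite ger0_norm// posnegD lerDr.
Qed.

(** The minuend and subtrahend need not be the positive and negative parts of their difference.
    [esumB] reconciles the two decompositions; finiteness holds because (f - g)^+ <= f and (f - g)^-
    <= g. *)
Let ge0_rsumB T (f g : T -> R) : (forall i, 0 <= f i) -> (forall i, 0 <= g i) ->
  summ f -> summ g -> rsum (fun i => f i - g i) = rsum f - rsum g.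
Proof.
move=> f0 g0 sf sg.
have esum_fin (h : T -> R) : summ h ->
    \esum_(i in [set: T]) (`|h i|)%:E \is a fin_num.
  by move=> ?; rewrite ge0_fin_numE// esum_ge0// => i _; rewrite lee_fin.
have := @esumB R T setT (EFin \o f) (EFin \o g) sf sg
  (fun i _ => f0 i) (fun i _ => g0 i).
rewrite [in RHS]/comp /= [in X in _ = X -> _]ge0_esum_rsum//.
rewrite [in X in _ = X -> _]ge0_esum_rsum//.
move=> /(congr1 fine); rewrite /= => <-; rewrite fineB//.
- rewrite ge0_fin_numE; last by apply: esum_ge0.
  apply: le_lt_trans sf; apply: le_esum => i _.
  rewrite funeposE/= -EFinB -EFin_max lee_fin ger0_norm// ge_max f0 andbT.
  by rewrite gerBl.
- rewrite ge0_fin_numE; last by apply: esum_ge0.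
  apply: le_lt_trans sg; apply: le_esum => i _.
  rewrite funenegE/= -?EFinB -?EFinN -EFin_max lee_fin ger0_norm// ge_max g0 andbT.
  by rewrite opprB gerBl.
Qed.

Let ge0_rsumD T (f g : T -> R) : (forall i, 0 <= f i) -> (forall i, 0 <= g i) ->
  summ f -> summ g -> rsum (fun i => f i + g i) = rsum f + rsum g.
Proof.
move=> f0 g0 sf sg; have : (\esum_(i in [set: T]) (f i + g i)%:E =
  \esum_(i in [set: T]) (f i)%:E + \esum_(i in [set: T]) (g i)%:E)%E.
  by rewrite -esumD// => i _; rewrite lee_fin.
rewrite (ge0_esum_rsum f0 sf) (ge0_esum_rsum g0 sg).
rewrite (ge0_esum_rsum (fun i => addr_ge0 (f0 i) (g0 i)) (summD sf sg)).
by case.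
Qed.

(** f + g is (f^+ + g^+) - (f^- + g^-), a difference of nonnegative summable families, which reduces
    the claim to additivity of nonnegative sums. *)
Lemma rsumD T (f g : T -> R) : summ f -> summ g ->
  rsum (fun i => f i + g i) = rsum f + rsum g.
Proof.
move=> sf sg.
have E (h : T -> R) : summ h -> rsum h = rsum (pos h) - rsum (neg h).
  move=> sh; rewrite -ge0_rsumB//; [|exact: summ_pos|exact: summ_neg].
  by apply: eq_rsum => i; exact: posneg.
rewrite (E f)// (E g)//.
transitivity (rsum (fun i => (pos f i + pos g i) - (neg f i + neg g i))).
  by apply: eq_rsum => i; rewrite (posneg f) (posneg g); lra.
have [? ?] := (summ_pos sf, summ_pos sg).
have [? ?] := (summ_neg sf, summ_neg sg).
rewrite ge0_rsumB; do ?by move=> i; rewrite addr_ge0.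
- by rewrite !ge0_rsumD//; lra.
- exact: summD.
- exact: summD.
Qed.

Lemma rsum0 T : rsum (fun _ : T => 0) = 0 :> R.
Proof. by rewrite ge0_rsumE// esum1. Qed.

Lemma rsumN T (f : T -> R) : summ f -> rsum (fun i => - f i) = - rsum f.
Proof.
move=> sf; have : rsum (fun i => f i + - f i) = 0.
  by rewrite -[RHS](rsum0 T); apply: eq_rsum => i; rewrite subrr.
rewrite rsumD//; last exact: summN.
by move/eqP; rewrite addrC addr_eq0 => /eqP.
Qed.

Lemma rsumB T (f g : T -> R) : summ f -> summ g ->
  rsum (fun i => f i - g i) = rsum f - rsum g.
Proof. by move=> sf sg; rewrite rsumD//; [rewrite rsumN|exact: summN]. Qed.

Lemma ler_rsum T (f g : T -> R) : summ f -> summ g ->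
  (forall i, f i <= g i) -> rsum f <= rsum g.
Proof.
move=> sf sg fg; rewrite -subr_ge0 -rsumB//.
by apply: rsum_ge0 => i; rewrite subr_ge0.
Qed.

Lemma ge0_sum_le_rsum T (f : T -> R) (s : seq T) : (forall i, 0 <= f i) ->
  summ f -> uniq s -> \sum_(i <- s) f i <= rsum f.
Proof.
by move=> f0 sf us; rewrite -lee_fin -ge0_esum_rsum//; exact: sum_le_esum.
Qed.

Lemma ge0_rsum_bound T (f : T -> R) M : (forall i, 0 <= f i) ->
  (forall s : seq T, uniq s -> \sum_(i <- s) f i <= M) ->
  summ f /\ rsum f <= M.
Proof.
move=> f0 H; have sf : summ f.
  apply: (@summ_bound _ _ M) => s us; under eq_bigr do rewrite ger0_norm//.
  exact: H.
split=> //; rewrite -lee_fin -ge0_esum_rsum//.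
by apply: esum_le_bound => s us; rewrite lee_fin H.
Qed.

(** For nonnegative data, finite sums give one inequality, and the same inequality with the inverse
    factor gives the other. The signs of f and then of c are removed afterwards. *)
Lemma rsumZ T (f : T -> R) c : summ f -> rsum (fun i => c * f i) = c * rsum f.
Proof.
move=> sf.
have le (a : R) (g : T -> R) : 0 <= a -> (forall i, 0 <= g i) -> summ g ->
    rsum (fun i => a * g i) <= a * rsum g.
  move=> a0 g0 sg; apply: (proj2 (ge0_rsum_bound _ _)).
    by move=> i; rewrite mulr_ge0.
  by move=> s us; rewrite -mulr_sumr ler_wpM2l// ge0_sum_le_rsum.
have eq (a : R) (g : T -> R) : 0 <= a -> (forall i, 0 <= g i) -> summ g ->
    rsum (fun i => a * g i) = a * rsum g.
  move=> a0 g0 sg; apply/eqP; rewrite eq_le le//=.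
  have [->|a_neq0] := eqVneq a 0.
    by rewrite mul0r rsum_ge0// => i; rewrite mul0r.
  have {}a0 : 0 < a by rewrite lt_def a_neq0.
  rewrite -ler_pdivlMl//.
  have := @le a^-1 (fun i => a * g i).
  rewrite invr_ge0 (ltW a0) => /(_ isT _ (@summZ _ g a sg)) H.
  apply: le_trans (H _); last by move=> i; rewrite mulr_ge0// ltW.
  by rewrite (eq_rsum (fun i => mulKf a_neq0 (g i))).
have pc (a : R) (g : T -> R) : 0 <= a -> summ g ->
    rsum (fun i => a * g i) = a * rsum g.
  move=> a0 sg; have [sp sn] := (summ_pos sg, summ_neg sg).
  rewrite (eq_rsum (posneg g)) rsumB// mulrBr -!eq// -rsumB; do ?exact: summZ.
  by apply: eq_rsum => i; rewrite (posneg g) mulrBr.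
have [c0|c0] := leP 0 c; first exact: pc.
have := @pc (- c) f; rewrite oppr_ge0 ltW// => /(_ isT sf).
rewrite mulNr => /(congr1 -%R); rewrite opprK => <-.
rewrite -rsumN; last exact: summZ.
by apply: eq_rsum => i; rewrite mulNr opprK.
Qed.

Lemma ge0_rsum_eq0 T (f : T -> R) : (forall i, 0 <= f i) -> summ f ->
  rsum f = 0 -> forall i, f i = 0.
Proof.
move=> f0 sf f00 i; apply/eqP; rewrite eq_le f0 andbT -f00.
by have := @ge0_sum_le_rsum T f [:: i] f0 sf isT; rewrite big_seq1.
Qed.

Lemma le_rsum1 T (f : T -> R) i : (forall i, 0 <= f i) -> summ f -> f i <= rsum f.
Proof.
by move=> f0 sf; have := @ge0_sum_le_rsum T f [:: i] f0 sf isT; rewrite big_seq1.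
Qed.

(** * Finitely supported families and tails of sums *)

Lemma summ_seq T (f : T -> R) (s : seq T) :
  (forall i, i \notin s -> f i = 0) -> summ f.
Proof.
move=> fs; apply: (@summ_bound _ _ (\sum_(i <- undup s) `|f i|)) => r ur.
rewrite (bigID (mem s))/= [X in _ + X]big1 ?addr0; last first.
  by move=> i /fs ->; rewrite normr0.
rewrite -big_filter; have : {subset [seq i <- r | i \in s] <= undup s}.
  by move=> i; rewrite mem_filter mem_undup => /andP[].
set q := [seq i <- r | i \in s] => qs; have uq : uniq q by exact: filter_uniq.
clearbody q.
rewrite [leRHS](bigID (mem q))/= -[leLHS]addr0 lerD ?sumr_ge0//.
rewrite -[leRHS]big_filter le_eqVlt; apply/orP; left; apply/eqP/perm_big.
apply: uniq_perm => //.
  by rewrite filter_uniq// undup_uniq.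
move=> i; rewrite mem_filter; apply/idP/andP => [iq|[]//]; split=> //.
exact: qs.
Qed.

Lemma rsum_seq T (f : T -> R) (s : seq T) : uniq s ->
  (forall i, i \notin s -> f i = 0) -> rsum f = \sum_(i <- s) f i.
Proof.
move=> us fs.
have ge0 (g : T -> R) : (forall i, 0 <= g i) ->
    (forall i, i \notin s -> g i = 0) -> rsum g = \sum_(i <- s) g i.
  move=> g0 gs; apply/eqP; rewrite eq_le ge0_sum_le_rsum//; last exact: summ_seq gs.
  rewrite andbT; apply: (proj2 (ge0_rsum_bound g0 _)) => r ur.
  rewrite (bigID (mem s))/= [X in _ + X]big1 ?addr0; last first.
    by move=> i /gs.
  rewrite -big_filter [leRHS](bigID (mem r))/= -[leLHS]addr0 lerD ?sumr_ge0//.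
  rewrite -[leRHS]big_filter le_eqVlt; apply/orP; left; apply/eqP/perm_big.
  apply: uniq_perm; rewrite ?filter_uniq// => i.
  by rewrite !mem_filter andbC.
rewrite (eq_rsum (posneg f)) rsumB//.
- rewrite !ge0//; last 2 first.
  + by move=> i /fs; rewrite /neg => ->; rewrite oppr0 maxxx.
  + by move=> i /fs; rewrite /pos => ->; rewrite maxxx.
  by rewrite -sumrB; apply: eq_bigr => i _; rewrite -posneg.
- exact/summ_pos/summ_seq/fs.
- exact/summ_neg/summ_seq/fs.
Qed.

(** The sum of |f| is the supremum of its finite partial sums, so some partial sum misses it by less
    than e. *)
Lemma rsum_tail T (f : T -> R) e : summ f -> 0 < e -> exists2 s : seq T,
  uniq s & rsum (fun i => if i \in s then 0 else `|f i|) < e.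
Proof.
move=> /summ_norm sf e0.
have [s us sP] : exists2 s : seq T, uniq s &
    rsum (fun i => `|f i|) - e < \sum_(i <- s) `|f i|.
  apply: contrapT => H.
  suff : rsum (fun i => `|f i|) <= rsum (fun i => `|f i|) - e by lra.
  apply: (proj2 (ge0_rsum_bound _ _)) => // s us.
  by rewrite leNgt; apply/negP => ?; apply: H; exists s.
exists s => //.
have E : rsum (fun i => if i \in s then `|f i| else 0) = \sum_(i <- s) `|f i|.
  rewrite (rsum_seq us) => [|i /negPf ->//].
  by apply: eq_big_seq => i ->.
rewrite -{}E in sP.
have S1 : summ (fun i => if i \in s then `|f i| else 0).
  by apply: summ_le sf => i; case: ifP; rewrite ?normr_id ?normr0.
have S2 : summ (fun i => if i \in s then 0 else `|f i|).
  by apply: summ_le sf => i; case: ifP; rewrite ?normr_id ?normr0.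
move: sP; rewrite ltrBlDr -ltrBlDl => sP; apply: le_lt_trans sP.
rewrite lerBrDl -rsumD// ler_rsum//; first exact: summD.
by move=> i; case: ifP; rewrite ?addr0 ?add0r.
Qed.

End RealSums.

(** * Sums over pairs: Tonelli, Fubini and exchange of coordinates *)

Section DoubleSums.
Variables (R : realType) (T1 T2 : choiceType).
Implicit Types f : T1 * T2 -> R.

Lemma summ_slice f x : summ f -> summ (fun y => f (x, y)).
Proof.
move=> /sum_norm_le[M [_ H]]; apply: (@summ_bound _ _ _ M) => s us.
rewrite -(big_map (pair x) xpredT (fun p => `|f p|)); apply: H.
by rewrite map_inj_uniq// => ? ? [].
Qed.

Lemma ge0_esum_pair f : (forall p, 0 <= f p) ->
  (\esum_(p in [set: T1 * T2]) (f p)%:E =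
   \esum_(x in [set: T1]) \esum_(y in [set: T2]) (f (x, y))%:E)%E.
Proof.
move=> f0; rewrite (@esum_esum _ _ _ _ (fun _ => setT) (fun x y => (f (x, y))%:E)).
  by congr esum; [apply/seteqP; split|apply/funext => -[]].
by move=> *; rewrite lee_fin.
Qed.

Lemma ge0_rsum_pair f : (forall p, 0 <= f p) -> summ f ->
  summ (fun x => rsum (fun y => f (x, y))) /\
  rsum f = rsum (fun x => rsum (fun y => f (x, y))).
Proof.
move=> f0 sf; have r0 x : 0 <= rsum (fun y => f (x, y)) by exact: rsum_ge0.
have E : (\esum_(p in [set: T1 * T2]) (f p)%:E =
          \esum_(x in [set: T1]) (rsum (fun y => f (x, y)))%:E)%E.
  rewrite ge0_esum_pair//; apply: eq_esum => x _.
  by rewrite ge0_esum_rsum//; exact: summ_slice.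
have s' : summ (fun x => rsum (fun y => f (x, y))).
  by apply/ge0_summ => //; rewrite -E; apply/ge0_summ.
by split => //; apply: EFin_inj; rewrite -!ge0_esum_rsum.
Qed.

(** Fubini follows from the nonnegative case by writing f as |f| - (|f| - f). *)
Lemma rsum_pair f : summ f ->
  summ (fun x => rsum (fun y => f (x, y))) /\
  rsum f = rsum (fun x => rsum (fun y => f (x, y))).
Proof.
move=> sf.
pose g p := `|f p|; pose h p := `|f p| - f p.
have g0 p : 0 <= g p by exact: normr_ge0.
have h0 p : 0 <= h p by rewrite subr_ge0 ler_norm.
have sg : summ g by exact: summ_norm.
have sh : summ h by exact: summB.
have [g1 g2] := ge0_rsum_pair g0 sg.
have [h1 h2] := ge0_rsum_pair h0 sh.
have fE p : f p = g p - h p by rewrite /g /h; lra.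
have E x : rsum (fun y => f (x, y)) =
    rsum (fun y => g (x, y)) - rsum (fun y => h (x, y)).
  by rewrite -rsumB; [apply: eq_rsum => y; exact: fE|exact: summ_slice..].
split; first by apply: eq_summ (summB g1 h1) => x; rewrite E.
by rewrite (eq_rsum fE) rsumB// g2 h2 -rsumB//; apply: eq_rsum => x; rewrite E.
Qed.

(** Tonelli as a criterion for summability: a summable majorant [g] of the row sums of |f|
    suffices. *)
Lemma summ_pair f (g : T1 -> R) : (forall x, summ (fun y => f (x, y))) ->
  (forall x, rsum (fun y => `|f (x, y)|) <= g x) -> summ g -> summ f.
Proof.
move=> fx fg sg; rewrite /summ ge0_esum_pair//.
apply: le_lt_trans sg; apply: le_esum => x _.
rewrite ge0_esum_rsum//; last exact: summ_norm.
by rewrite lee_fin (le_trans (fg x))// ler_norm.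
Qed.

End DoubleSums.

Lemma summ_swap (R : realType) (T1 T2 : choiceType) (f : T1 * T2 -> R) :
  summ f -> summ (fun p : T2 * T1 => f (p.2, p.1)).
Proof.
move=> /sum_norm_le[M [_ H]]; apply: (@summ_bound _ _ _ M) => s us.
rewrite -(big_map (fun p : T2 * T1 => (p.2, p.1)) xpredT (fun p => `|f p|)).
by apply: H; rewrite map_inj_uniq// => -[? ?] [? ?] /= [-> ->].
Qed.

(** For nonnegative families the inequality [le], proved for all pairs of index types, is applied
    once in each direction. *)
Lemma rsum_swap (R : realType) (T1 T2 : choiceType) (f : T1 * T2 -> R) :
  summ f -> rsum (fun p : T2 * T1 => f (p.2, p.1)) = rsum f.
Proof.
have le (U1 U2 : choiceType) (g : U1 * U2 -> R) : (forall p, 0 <= g p) ->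
    summ g -> rsum (fun p : U2 * U1 => g (p.2, p.1)) <= rsum g.
  move=> g0 sg; apply: (proj2 (ge0_rsum_bound _ _)) => // s us.
  rewrite -(big_map (fun p : U2 * U1 => (p.2, p.1)) xpredT g).
  by rewrite ge0_sum_le_rsum// map_inj_uniq// => -[? ?] [? ?] /= [-> ->].
have eq (g : T1 * T2 -> R) : (forall p, 0 <= g p) -> summ g ->
    rsum (fun p : T2 * T1 => g (p.2, p.1)) = rsum g.
  move=> g0 sg; apply/eqP; rewrite eq_le le//=.
  have := @le _ _ (fun p : T2 * T1 => g (p.2, p.1)) (fun=> g0 _) (summ_swap sg).
  by rewrite [leLHS](_ : _ = rsum g)//; apply: eq_rsum => -[].
move=> sf; pose h p := `|f p| - f p.
have h0 p : 0 <= h p by rewrite subr_ge0 ler_norm.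
have sg := summ_norm sf.
have sh : summ h by exact: summB.
have fE p : f p = `|f p| - h p by rewrite /h; lra.
rewrite [RHS](eq_rsum fE) rsumB// -!eq// -rsumB;
  [|exact: (summ_swap sg)|exact: (summ_swap sh)].
by apply: eq_rsum => p.
Qed.
(** * Weighted square-summable functions *)

Lemma le0_of_le_eps (R : realFieldType) (a c : R) :
  (forall e : R, 0 < e -> a <= c * e) -> a <= 0.
Proof.
move=> H; rewrite leNgt; apply/negP => a0.
have c0 : 0 < `|c| + 1 by rewrite ltr_wpDl.
(* For this e the bound c e is at most a / 2; the summand 1 keeps the divisor positive when c =
   0. *)
have := H (a / 2 / (`|c| + 1)); rewrite !divr_gt0// => /(_ isT).
have : c * (a / 2 / (`|c| + 1)) <= a / 2.
  rewrite mulrA ler_pdivrMr// [leLHS]mulrC ler_pM2l ?divr_gt0//.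
  by rewrite (le_trans (ler_norm _))// lerDl.
by move=> h1 h2; have := le_trans h2 h1; lra.
Qed.

(** Evaluation at the minimizer t = b / c. If c = 0 the polynomial is affine in t and takes the
    value -1 somewhere unless b = 0. *)
Lemma discriminant_le (R : realFieldType) (a b c : R) : 0 <= c ->
  (forall t, 0 <= a - 2 * t * b + t ^+ 2 * c) -> b ^+ 2 <= a * c.
Proof.
move=> c0 H; have [c00|c_neq0] := eqVneq c 0.
  subst c; rewrite mulr0.
  have [->|b0] := eqVneq b 0; first by rewrite expr0n.
  have := H ((a + 1) / (2 * b)).
  rewrite (_ : a - 2 * ((a + 1) / (2 * b)) * b + _ = -1); last by field.
  by rewrite oppr_ge0 ler10.
have cp : 0 < c by rewrite lt_def c_neq0.
have := H (b / c); rewrite (_ : _ + _ = (a * c - b ^+ 2) / c); last by field.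
by rewrite pmulr_lge0 ?invr_gt0// subr_ge0.
Qed.

Section WeightedL2.
Variables (R : realType) (T : choiceType) (m : T -> R).
Hypothesis m_ge0 : forall i, 0 <= m i.
Implicit Types f g h : T -> R.

(** The weight is arbitrary so that the same facts serve functions on vertices, weighted by the
    measure, and gradients on pairs of vertices, weighted by the edge weights. *)
Definition l2w f : Prop := summ (fun i => f i ^+ 2 * m i).
Definition wip f g : R := rsum (fun i => f i * g i * m i).

Let sqm_ge0 f i : 0 <= f i ^+ 2 * m i.
Proof. by rewrite mulr_ge0// sqr_ge0. Qed.

Lemma summ_wip f g : l2w f -> l2w g -> summ (fun i => f i * g i * m i).
Proof.
move=> sf sg; apply: summ_le (summD sf sg) => i.
rewrite !normrM (ger0_norm (m_ge0 i)) -mulrDl ler_wpM2r//.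
rewrite -(real_normK (num_real (f i))) -(real_normK (num_real (g i))).
by have := sqr_ge0 (`|f i| - `|g i|);
  have := sqr_ge0 (`|f i|); have := sqr_ge0 (`|g i|); rewrite !expr2; nra.
Qed.

Lemma l2w_sq f : l2w f -> summ (fun i => f i * f i * m i).
Proof. by []. Qed.

Lemma l2wZ c f : l2w f -> l2w (fun i => c * f i).
Proof. by move=> /(summZ (c ^+ 2)); apply: eq_summ => i; rewrite exprMn mulrA. Qed.

Lemma l2wD f g : l2w f -> l2w g -> l2w (fun i => f i + g i).
Proof.
move=> sf sg; have := summD (summD sf sg) (summZ 2 (summ_wip sf sg)).
by apply: eq_summ => i; ring.
Qed.

Lemma l2wN f : l2w f -> l2w (fun i => - f i).
Proof. by apply: eq_summ => i; rewrite sqrrN. Qed.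

Lemma l2wB f g : l2w f -> l2w g -> l2w (fun i => f i - g i).
Proof. by move=> sf /l2wN; exact: l2wD. Qed.

Lemma eq_l2w f g : (forall i, f i = g i) -> l2w f -> l2w g.
Proof. by move=> /funext ->. Qed.

Lemma le_l2w f g : (forall i, `|f i| <= `|g i|) -> l2w g -> l2w f.
Proof.
move=> fg; apply: summ_le => i; rewrite ger0_norm// ler_wpM2r//.
rewrite -(real_normK (num_real (f i))) -(real_normK (num_real (g i))).
by rewrite ler_sqr ?nnegrE.
Qed.

Lemma wipC f g : wip f g = wip g f.
Proof. by apply: eq_rsum => i; rewrite (mulrC (f i)). Qed.

Lemma eq_wip f g h k : (forall i, f i = h i) -> (forall i, g i = k i) ->
  wip f g = wip h k.
Proof. by move=> /funext -> /funext ->. Qed.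

Lemma wipDl f g h : l2w f -> l2w g -> l2w h ->
  wip (fun i => f i + g i) h = wip f h + wip g h.
Proof.
move=> sf sg sh; rewrite -rsumD; [|exact: summ_wip..].
by apply: eq_rsum => i; ring.
Qed.

Lemma wipZl c f h : l2w f -> l2w h -> wip (fun i => c * f i) h = c * wip f h.
Proof.
move=> sf sh; rewrite -rsumZ; last exact: summ_wip.
by apply: eq_rsum => i; ring.
Qed.

Lemma wipBl f g h : l2w f -> l2w g -> l2w h ->
  wip (fun i => f i - g i) h = wip f h - wip g h.
Proof.
move=> sf sg sh; rewrite -rsumB; [|exact: summ_wip..].
by apply: eq_rsum => i; ring.
Qed.

Lemma wipDr f g h : l2w f -> l2w g -> l2w h ->
  wip h (fun i => f i + g i) = wip h f + wip h g.
Proof. by move=> *; rewrite wipC wipDl// !(wipC h). Qed.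

Lemma wipZr c f h : l2w f -> l2w h -> wip h (fun i => c * f i) = c * wip h f.
Proof. by move=> *; rewrite wipC wipZl// (wipC h). Qed.

Lemma wipBr f g h : l2w f -> l2w g -> l2w h ->
  wip h (fun i => f i - g i) = wip h f - wip h g.
Proof. by move=> *; rewrite wipC wipBl// !(wipC h). Qed.

Lemma wip_ge0 f : 0 <= wip f f.
Proof. by apply: rsum_ge0 => i; rewrite -expr2. Qed.

Lemma wipDD f g : l2w f -> l2w g ->
  wip (fun i => f i + g i) (fun i => f i + g i) = wip f f + 2 * wip f g + wip g g.
Proof.
move=> sf sg; have sfg := l2wD sf sg.
by rewrite wipDl// !wipDr// (wipC g f); ring.
Qed.

Lemma wipBB f g : l2w f -> l2w g ->
  wip (fun i => f i - g i) (fun i => f i - g i) = wip f f - 2 * wip f g + wip g g.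
Proof.
move=> sf sg; have sfg := l2wB sf sg.
by rewrite wipBl// !wipBr// (wipC g f); ring.
Qed.

(** The discriminant of the nonnegative polynomial |f - t g|^2 in t. *)
Lemma wip_CS f g : l2w f -> l2w g -> wip f g ^+ 2 <= wip f f * wip g g.
Proof.
move=> sf sg; apply: discriminant_le (wip_ge0 g) _ => t.
have := wip_ge0 (fun i => f i - t * g i).
have sh := l2wZ t sg.
by rewrite wipBB// wipZr// wipZl// wipZr//; congr (_ <= _); ring.
Qed.

Lemma wipD_le f g : l2w f -> l2w g ->
  wip (fun i => f i + g i) (fun i => f i + g i) <= 2 * wip f f + 2 * wip g g.
Proof.
move=> sf sg; have := wip_ge0 (fun i => f i - g i).
by rewrite wipBB// wipDD//; lra.
Qed.

Lemma wip_eq0 f : (forall i, 0 < m i) -> l2w f -> wip f f = 0 -> forall i, f i = 0.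
Proof.
move=> m0 sf f0 i; have /eqP : f i ^+ 2 * m i = 0.
  apply: (ge0_rsum_eq0 (sqm_ge0 f) sf); rewrite -[RHS]f0.
  by apply: eq_rsum => j; rewrite expr2.
by rewrite mulf_eq0 sqrf_eq0 (gt_eqF (m0 i)) orbF => /eqP.
Qed.

Lemma le_wip1 f i : l2w f -> f i ^+ 2 * m i <= wip f f.
Proof.
move=> sf; apply: le_trans (le_rsum1 i (sqm_ge0 f) sf) _.
by rewrite le_eqVlt; apply/orP; left; apply/eqP/eq_rsum => j; rewrite expr2.
Qed.

Lemma wip_bound f M :
  (forall s : seq T, uniq s -> \sum_(i <- s) f i ^+ 2 * m i <= M) ->
  l2w f /\ wip f f <= M.
Proof. exact: ge0_rsum_bound (sqm_ge0 f).
Qed.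

End WeightedL2.

(* [d] is the squared distance from [f] to [V]: the elements of [f - V] of almost
   minimal norm are close to each other, and their pointwise limit, which exists
   without any appeal to completeness of L^2, is orthogonal to [V]. *)

Section Density.
Variables (R : realType) (T : choiceType) (m : T -> R).
Hypothesis m_gt0 : forall i, 0 < m i.
Variable V : set (T -> R).
Hypothesis V_l2w : forall v, V v -> l2w m v.
Hypothesis V_lin : forall c v w, V v -> V w -> V (fun i => v i + c * w i).
Variable f : T -> R.
Hypothesis f_l2w : l2w m f.

Let m_ge0 i : 0 <= m i. Proof. exact: ltW. Qed.
Let N g := wip m g g.
Let K := [set g | V (fun i => f i - g i)].

Let K_l2w g : K g -> l2w m g.
Proof.
move=> /V_l2w /(l2wB m_ge0 f_l2w); apply: eq_l2w => i.
by rewrite opprB addrCA subrr addr0.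
Qed.

Let K_mid g h : K g -> K h -> K (fun i => (g i + h i) / 2).
Proof.
move=> Kg Kh; have Vd := V_lin (-1) Kg Kh.
have := V_lin (- 2^-1) Kg Vd.
by rewrite /K /=; congr V; apply/funext => i; field.
Qed.

Let K_line g v t : K g -> V v -> K (fun i => g i - t * v i).
Proof.
move=> Kg Vv; have := V_lin t Kg Vv.
by rewrite /K /=; congr V; apply/funext => i; ring.
Qed.

Variable d : R.
Hypothesis d_le : forall g, K g -> d <= N g.
Hypothesis d_adh : forall e : R, 0 < e -> exists2 g, K g & N g < d + e.

(** Parallelogram law: N (g - h) = 2 N g + 2 N h - 4 N ((g + h) / 2), and the midpoint lies in [K],
    so its [N] is at least d. *)
Let cauchy e g h : K g -> K h -> N g < d + e -> N h < d + e ->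
  N (fun i => g i - h i) <= 4 * e.
Proof.
move=> Kg Kh Ng Nh; have := d_le (K_mid Kg Kh).
have [sg sh] := (K_l2w Kg, K_l2w Kh).
rewrite /N in Ng Nh *.
rewrite (@eq_wip _ _ m _ _ (fun i => 2^-1 * (g i + h i)) (fun i => 2^-1 * (g i + h i))).
- have sgh := l2wD m_ge0 sg sh.
  rewrite wipZl//; last exact: l2wZ.
  by rewrite wipZr// wipDD// wipBB//; lra.
- by move=> i; rewrite mulrC.
- by move=> i; rewrite mulrC.
Qed.

(** The supremum [w x] of this set is the lower limit of g x as g runs through [K] with N g tending
    to d, so no minimizing sequence has to be chosen. [r e x] is the pointwise form of the bound
    [cauchy]. *)
Let A x := [set a | exists2 e, 0 < e & forall g, K g -> N g < d + e -> a <= g x].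
Let w x := sup (A x).
Let r e x := Num.sqrt (4 * e / m x).

Let near_pt e g h x : K g -> K h -> N g < d + e -> N h < d + e ->
  `|g x - h x| <= r e x.
Proof.
move=> Kg Kh Ng Nh; have sgh := l2wB m_ge0 (K_l2w Kg) (K_l2w Kh).
have e0 : 0 < e by have := d_le Kg; lra.
rewrite -ler_sqr ?nnegrE ?sqrtr_ge0// sqr_sqrtr; last first.
  by rewrite divr_ge0// mulr_ge0// ltW.
rewrite real_normK ?num_real// ler_pdivlMr//.
exact: le_trans (le_wip1 m_ge0 x sgh) (cauchy Kg Kh Ng Nh).
Qed.

(** By [near_pt], g x - r e x belongs to [A x]. Comparison with an element closer to minimal shows
    that g x + r e x is an upper bound of [A x]. *)
Let w_near e g x : K g -> N g < d + e -> `|g x - w x| <= r e x.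
Proof.
move=> Kg Ng; have e0 : 0 < e by have := d_le Kg; lra.
have ub a : A x a -> a <= g x + r e x.
  move=> [e' e'0 H]; have [|h Kh Nh] := d_adh (_ : 0 < Num.min e e').
    by rewrite lt_min e0.
  have Nhe : N h < d + e by apply: lt_le_trans Nh _; rewrite lerD2l ge_min lexx.
  have := near_pt x Kg Kh Ng Nhe; rewrite ler_norml => /andP[h1 h2].
  have : a <= h x.
    by apply: H => //; apply: lt_le_trans Nh _; rewrite lerD2l ge_min lexx orbT.
  by lra.
have Ag : A x (g x - r e x).
  exists e => // h Kh Nh.
  by have := near_pt x Kg Kh Ng Nh; rewrite ler_norml => /andP[h1 h2]; lra.
rewrite ler_norml; apply/andP; split.
  suff : w x <= g x + r e x by lra.
  by apply: ge_sup => //; exists (g x - r e x).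
suff : g x - r e x <= w x by lra.
by apply: ub_le_sup => //; exists (g x + r e x).
Qed.

Let w_near_sq e g x : K g -> N g < d + e -> (g x - w x) ^+ 2 * m x <= 4 * e.
Proof.
move=> Kg Ng; have e0 : 0 < e by have := d_le Kg; lra.
have := w_near x Kg Ng.
rewrite -ler_sqr ?nnegrE ?sqrtr_ge0// sqr_sqrtr; last first.
  by rewrite divr_ge0// mulr_ge0// ltW.
by rewrite real_normK ?num_real// ler_pdivlMr.
Qed.

Let w_approx e g : K g -> N g < d + e ->
  l2w m (fun i => g i - w i) /\ N (fun i => g i - w i) <= 16 * e.
Proof.
move=> Kg Ng; have e0 : 0 < e by have := d_le Kg; lra.
apply: wip_bound => // s us.
have n0 : 0 < (size s).+1%:R :> R by rewrite ltr0Sn.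
(* On the finite set s the limit is replaced by an h so close to minimal that the pointwise errors 8
   e / (|s| + 1) add up to at most 8 e. Together with twice the bound 4 e on N (g - h) this gives 16
   e. *)
have [|h Kh Nh] := d_adh (_ : 0 < e / (size s).+1%:R); first by rewrite divr_gt0.
have Nhe : N h < d + e.
  apply: lt_le_trans Nh _; rewrite lerD2l ler_pdivrMr// ler_peMr//; first exact: ltW.
  by rewrite ler1n.
have sgh := l2wB m_ge0 (K_l2w Kg) (K_l2w Kh).
apply: (@le_trans _ _ (2 * \sum_(i <- s) (g i - h i) ^+ 2 * m i +
    \sum_(i <- s) 8 * (e / (size s).+1%:R))).
  rewrite mulr_sumr -big_split/=; apply: ler_sum => i _.
  have := w_near_sq i Kh Nh.
  have : (g i - w i) ^+ 2 * m i <=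
      2 * ((g i - h i) ^+ 2 * m i) + 2 * ((h i - w i) ^+ 2 * m i).
    rewrite !mulrA -mulrDl ler_wpM2r//.
    by have := sqr_ge0 (g i - h i - (h i - w i)); rewrite !expr2; lra.
  move: (e / _) ((g i - w i) ^+ 2 * m i) ((g i - h i) ^+ 2 * m i) => *.
  by lra.
have h1 : \sum_(i <- s) (g i - h i) ^+ 2 * m i <= 4 * e.
  apply: le_trans (cauchy Kg Kh Ng Nhe).
  apply: le_trans (ge0_sum_le_rsum _ sgh us) _.
    by move=> i; rewrite mulr_ge0// sqr_ge0.
  by rewrite le_eqVlt; apply/orP; left; apply/eqP/eq_rsum => j; rewrite expr2.
have h2 : \sum_(i <- s) 8 * (e / (size s).+1%:R) <= 8 * e.
  rewrite big_const_seq count_predT iter_addr_0 -[leLHS]mulr_natr -!mulrA ler_pM2l//.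
  rewrite ler_piMr//; first exact: ltW.
  by rewrite mulrC ler_pdivrMr// mul1r ler_nat.
by lra.
Qed.

Let w_l2w : l2w m w.
Proof.
have [g Kg Ng] := d_adh ltr01.
have [h _] := w_approx Kg Ng.
by apply: eq_l2w (l2wB m_ge0 (K_l2w Kg) h) => i; ring.
Qed.

(** The line g - t v stays in [K], so N (g - t v) - d is a nonnegative polynomial in t; its
    discriminant gives the bound. *)
Let almost_orth e g v : K g -> N g < d + e -> V v -> wip m g v ^+ 2 <= N v * e.
Proof.
move=> Kg Ng Vv; have [sg sv] := (K_l2w Kg, V_l2w Vv).
have : wip m g v ^+ 2 <= (N g - d) * N v.
  apply: discriminant_le (wip_ge0 m_ge0 v) _ => t.
  have := d_le (K_line t Kg Vv); have stv := l2wZ t sv.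
  rewrite /N wipBB// wipZr// wipZl// wipZr// -subr_ge0.
  by congr (_ <= _); ring.
move=> /le_trans; apply; rewrite mulrC ler_wpM2l//; first exact: wip_ge0.
by lra.
Qed.

Lemma min_orthogonal : exists2 z, l2w m z &
  (forall v, V v -> wip m z v = 0) /\
  (forall e g, K g -> N g < d + e -> N (fun i => g i - z i) <= 16 * e).
Proof.
exists w => //; split; last first.
  by move=> e g Kg Ng; have [] := w_approx Kg Ng.
move=> v Vv; have sv := V_l2w Vv.
apply/eqP; rewrite -sqrf_eq0 eq_le sqr_ge0 andbT.
(* 34 = 2 (1 + 16): the factor 1 comes from [almost_orth], and 16 from Cauchy-Schwarz applied to g -
   w. *)
apply: (@le0_of_le_eps _ _ (34 * N v)) => e e0.
have [g Kg Ng] := d_adh e0; have [sgw Ngw] := w_approx Kg Ng.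
have h1 := almost_orth Kg Ng Vv.
have h2 := wip_CS m_ge0 sgw sv.
have h3 : wip m (fun i => g i - w i) (fun i => g i - w i) * wip m v v <=
    16 * e * wip m v v by rewrite ler_wpM2r// wip_ge0.
rewrite wipBl// in h2; last exact: K_l2w.
have := sqr_ge0 (wip m g v - (wip m g v - wip m w v)).
have := sqr_ge0 (wip m g v + (wip m g v - wip m w v)).
rewrite /N in h1 *.
by move: h1 h2 h3; rewrite !expr2; nra.
Qed.

End Density.

(** The limit of almost minimal elements of f - V is orthogonal to V, hence zero, so f - V contains
    elements of arbitrarily small norm. *)
Lemma dense_of_orthogonal (R : realType) (T : choiceType) (m : T -> R)
    (V : set (T -> R)) (f : T -> R) e :
  (forall i, 0 < m i) -> (exists v, V v) -> (forall v, V v -> l2w m v) ->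
  (forall c v w, V v -> V w -> V (fun i => v i + c * w i)) ->
  (forall z, l2w m z -> (forall v, V v -> wip m z v = 0) -> forall i, z i = 0) ->
  l2w m f -> 0 < e ->
  exists2 v, V v & wip m (fun i => f i - v i) (fun i => f i - v i) < e.
Proof.
move=> m0 [v0 Vv0] Vl Vlin Vperp fl e0.
have m_ge0 i : 0 <= m i by exact: ltW.
pose N g := wip m g g; pose K := [set g | V (fun i => f i - g i)].
pose B := [set N g | g in K].
have KfB v : V v -> K (fun i => f i - v i).
  by rewrite /K /=; congr V; apply/funext => i; ring.
have B0 : has_inf B.
  split.
    exists (N (fun i => f i - v0 i)), (fun i => f i - v0 i) => //.
    exact: KfB.
  by exists 0 => _ [g _ <-]; exact: wip_ge0.
have d_le g : K g -> inf B <= N g.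
  by move=> Kg; apply: ge_inf => //; [case: B0|exists g].
have d_adh e' : 0 < e' -> exists2 g, K g & N g < inf B + e'.
  by move=> e'0; have [_ [g Kg <-] Ng] := inf_adherent e'0 B0; exists g.
have [z zl [zV zN]] := min_orthogonal m0 Vl Vlin fl d_le d_adh.
have z0 := Vperp z zl zV.
(* The bound 16 (e / 32) = e / 2 makes the final inequality strict. *)
have [|g Kg Ng] := d_adh (e / 32); first by rewrite divr_gt0.
exists (fun i => f i - g i) => //.
have := zN _ _ Kg Ng.
rewrite (@eq_wip _ _ m _ _ (fun i => f i - (f i - g i)) (fun i => f i - (f i - g i))).
- by lra.
- by move=> i; rewrite z0; ring.
- by move=> i; rewrite z0; ring.
Qed.

(** * Energy forms on a weighted graph *)

Lemma sqrte_lty (R : realType) (x : \bar R) : (sqrte x < +oo)%E = (x < +oo)%E.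
Proof. by case: x => [r| |]//=; rewrite !ltry. Qed.

Lemma sqrte_lt_fin (R : realType) (r e : R) : 0 <= r -> 0 < e ->
  (sqrte r%:E < e%:E)%E = (r < e ^+ 2).
Proof.
move=> r0 e0; rewrite /= lte_fin -ltr_sqr ?nnegrE ?sqrtr_ge0 ?ltW//.
by rewrite sqr_sqrtr.
Qed.

Section GraphForms.
Variables (R : realType) (X : countType) (G : weighted_graph R X).
Implicit Types (u v f g : X -> R).

Let w := edge_weight G.
Let mu := vertex_measure G.

Let mu_gt0 x : 0 < mu x. Proof. exact: vertex_measure_gt0. Qed.
Let mu_ge0 x : 0 <= mu x. Proof. exact/ltW/mu_gt0. Qed.
Let w_ge0 x y : 0 <= w x y. Proof. exact: edge_weight_ge0. Qed.
Let wC x y : w x y = w y x. Proof. exact: edge_weight_sym. Qed.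

(** The energy is half the weighted inner product of gradients over ordered pairs, so Cauchy-Schwarz
    and the parallelogram law carry over from [wip]. *)
Definition wpair (p : X * X) : R := edge_weight G p.1 p.2.
Definition grad u (p : X * X) : R := u p.1 - u p.2.
Definition fin_energy u : Prop := l2w wpair (grad u).
Definition energy u v : R := 2^-1 * wip wpair (grad u) (grad v).
(** The real number [Deg] times the measure of the vertex. *)
Definition deg x : R := rsum (edge_weight G x).

Lemma wpair_ge0 p : 0 <= wpair p. Proof. exact: w_ge0. Qed.
Hint Resolve wpair_ge0 : core.

Lemma summ_weight x : summ (edge_weight G x).
Proof. by apply/ge0_summ => //; exact: edge_weight_summable. Qed.

Lemma deg_ge0 x : 0 <= deg x.
Proof. exact: rsum_ge0. Qed.

Lemma sqnorm2E u : l2w mu u -> sqnorm2 G u = (wip mu u u)%:E.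
Proof.
move=> su; rewrite /sqnorm2 (@ge0_esum_rsum _ _ (fun x => u x ^+ 2 * mu x))//.
by move=> x; rewrite mulr_ge0// sqr_ge0.
Qed.

Lemma L2P u : L2 G u <-> l2w mu u.
Proof.
rewrite /L2 /= /norm2 sqrte_lty /sqnorm2.
rewrite -(@ge0_summ _ _ (fun x => u x ^+ 2 * mu x))//.
by move=> x; rewrite mulr_ge0// sqr_ge0.
Qed.

Lemma norm2_lt u e : l2w mu u -> 0 < e ->
  (norm2 G u < e%:E)%E = (wip mu u u < e ^+ 2).
Proof. by move=> su e0; rewrite /norm2 sqnorm2E// sqrte_lt_fin//; exact: wip_ge0. Qed.

Lemma inner2E u v : inner2 G u v = wip mu u v.
Proof. by []. Qed.

Lemma QtildeE f : fin_energy f -> Qtilde G f = (energy f f)%:E.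
Proof.
move=> sf; rewrite /Qtilde.
rewrite (@ge0_esum_rsum _ _ (fun p => edge_weight G p.1 p.2 * (f p.1 - f p.2) ^+ 2)).
- rewrite -EFinM; congr (_ * _)%:E; apply: eq_rsum => p.
  by rewrite /grad /wpair; ring.
- by move=> p; rewrite mulr_ge0// ?sqr_ge0//; exact: w_ge0.
- by apply: eq_summ sf => p; rewrite mulrC.
Qed.

Lemma Qtilde_lty f : (Qtilde G f < +oo)%E <-> fin_energy f.
Proof.
split; last by move=> /QtildeE ->; rewrite ltry.
rewrite /Qtilde => H; suff : summ (fun p : X * X => w p.1 p.2 * (f p.1 - f p.2) ^+ 2).
  by apply: eq_summ => p; rewrite mulrC.
apply/ge0_summ => [p|]; first by rewrite mulr_ge0// sqr_ge0.
move: H; rewrite /w; case: (esum _ _) => [r||]//; first by rewrite !ltry.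
by rewrite gt0_muley// lte_fin invr_gt0.
Qed.

Lemma gradD f g p : grad (fun x => f x + g x) p = grad f p + grad g p.
Proof. by rewrite /grad; ring. Qed.

Lemma gradB f g p : grad (fun x => f x - g x) p = grad f p - grad g p.
Proof. by rewrite /grad; ring. Qed.

Lemma fin_energyD f g : fin_energy f -> fin_energy g ->
  fin_energy (fun x => f x + g x).
Proof.
move=> sf sg; apply: eq_l2w (l2wD wpair_ge0 sf sg) => p; exact/esym/gradD.
Qed.

Lemma fin_energyB f g : fin_energy f -> fin_energy g ->
  fin_energy (fun x => f x - g x).
Proof.
move=> sf sg; apply: eq_l2w (l2wB wpair_ge0 sf sg) => p; exact/esym/gradB.
Qed.

Lemma energyDD f g : fin_energy f -> fin_energy g ->
  energy (fun x => f x + g x) (fun x => f x + g x) =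
  energy f f + 2 * energy f g + energy g g.
Proof.
move=> sf sg; rewrite /energy (eq_wip _ (gradD f g) (gradD f g)) wipDD//; ring.
Qed.

Lemma energyBB f g : fin_energy f -> fin_energy g ->
  energy (fun x => f x - g x) (fun x => f x - g x) =
  energy f f - 2 * energy f g + energy g g.
Proof.
move=> sf sg; rewrite /energy (eq_wip _ (gradB f g) (gradB f g)) wipBB//; ring.
Qed.

Lemma energyBr f g h : fin_energy f -> fin_energy g -> fin_energy h ->
  energy h (fun x => f x - g x) = energy h f - energy h g.
Proof.
move=> sf sg sh.
rewrite /energy (eq_wip _ (fun=> erefl) (gradB f g)) wipBr//; ring.
Qed.

Lemma energyC f g : energy f g = energy g f.
Proof. by rewrite /energy wipC. Qed.

Lemma energy_ge0 f : 0 <= energy f f.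
Proof. by rewrite mulr_ge0// ?invr_ge0//; exact: wip_ge0. Qed.

Lemma energy_CS f g : fin_energy f -> fin_energy g ->
  energy f g ^+ 2 <= energy f f * energy g g.
Proof.
move=> sf sg; have := wip_CS wpair_ge0 sf sg.
rewrite /energy; move: (wip _ _ _) (wip _ _ _) (wip _ _ _) => a b c; nra.
Qed.

Lemma Qtilde_bilinE f g : fin_energy f -> fin_energy g ->
  Qtilde_bilin G f g = energy f g.
Proof.
move=> sf sg; rewrite /Qtilde_bilin.
rewrite (QtildeE (fin_energyD sf sg)) (QtildeE (fin_energyB sf sg)) /=.
by rewrite energyDD// energyBB//; field.
Qed.

(** * The form norm and bounds of the energy by the degree *)

Definition sqnormQ f := energy f f + wip mu f f.

Lemma sqnormQ_ge0 f : 0 <= sqnormQ f.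
Proof. by rewrite addr_ge0 ?energy_ge0// wip_ge0. Qed.

Lemma DQmaxP f : DQmax G f <-> l2w mu f /\ fin_energy f.
Proof. by rewrite /DQmax /= -L2P -Qtilde_lty. Qed.

Lemma normQ_lt f e : l2w mu f -> fin_energy f -> 0 < e ->
  (normQ G f < e%:E)%E = (sqnormQ f < e ^+ 2).
Proof.
move=> sf ef e0; rewrite /normQ QtildeE// sqnorm2E// -EFinD sqrte_lt_fin//.
exact: sqnormQ_ge0.
Qed.

Lemma sqnormQD_le f g : l2w mu f -> fin_energy f -> l2w mu g -> fin_energy g ->
  sqnormQ (fun x => f x + g x) <= 2 * sqnormQ f + 2 * sqnormQ g.
Proof.
move=> sf ef sg eg; have := energy_ge0 (fun x => f x - g x).
rewrite energyBB// => h; have := wipD_le mu_ge0 sf sg.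
by rewrite /sqnormQ energyDD//; lra.
Qed.

Lemma sq_grad_le u p : grad u p ^+ 2 <= 2 * u p.1 ^+ 2 + 2 * u p.2 ^+ 2.
Proof. by have := sqr_ge0 (u p.1 + u p.2); rewrite /grad !expr2; lra. Qed.

Lemma summ_wpair1 (h : X -> R) : summ (fun x => h x * deg x) ->
  summ (fun p => wpair p * h p.1) /\
  rsum (fun p => wpair p * h p.1) = rsum (fun x => h x * deg x).
Proof.
move=> sh; have sx x : summ (fun y => w x y * h x).
  by apply: eq_summ (summZ (h x) (summ_weight x)) => y; rewrite mulrC.
have s : summ (fun p => wpair p * h p.1).
  apply: (@summ_pair _ _ _ _ (fun x => `|h x * deg x|)) (summ_norm sh) => //= x.
  rewrite /wpair/= normrM (ger0_norm (deg_ge0 x)) -rsumZ; last exact: summ_weight.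
  rewrite (@eq_rsum _ _ _ (fun y => `|h x| * edge_weight G x y))// => y.
  by rewrite normrM (ger0_norm (w_ge0 _ _)) mulrC.
split=> //; have [_ ->] := rsum_pair s; apply: eq_rsum => x.
rewrite -rsumZ; last exact: summ_weight.
by apply: eq_rsum => y; rewrite mulrC.
Qed.

Lemma summ_wpair2 (h : X -> R) : summ (fun x => h x * deg x) ->
  summ (fun p => wpair p * h p.2) /\
  rsum (fun p => wpair p * h p.2) = rsum (fun x => h x * deg x).
Proof.
move=> /summ_wpair1[s <-].
have E : (fun p => wpair p * h p.2) =
    (fun p : X * X => (fun q => wpair q * h q.1) (p.2, p.1)).
  by apply/funext => p; rewrite /wpair/= -/w wC.
by rewrite E; split; [exact: (summ_swap s)|exact: (rsum_swap s)].
Qed.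

(** From (a - b)^2 <= 2 a^2 + 2 b^2; by symmetry of the weights both terms sum to the same multiple
    of the sum of u^2 [deg]. *)
Lemma fin_energy_deg u : summ (fun x => u x ^+ 2 * deg x) ->
  fin_energy u /\ energy u u <= 2 * rsum (fun x => u x ^+ 2 * deg x).
Proof.
move=> /[dup] /(@summ_wpair1 (fun x => u x ^+ 2))[s1 e1].
move=> /(@summ_wpair2 (fun x => u x ^+ 2))[s2 e2].
have s := summD (summZ 2 s1) (summZ 2 s2).
have le p : grad u p ^+ 2 * wpair p <=
    2 * (wpair p * u p.1 ^+ 2) + 2 * (wpair p * u p.2 ^+ 2).
  have := ler_wpM2l (wpair_ge0 p) (sq_grad_le u p).
  by move: (wpair p) => q; lra.
have su : fin_energy u.
  by apply: summ_le s => p; rewrite ger0_norm// mulr_ge0// sqr_ge0.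
split => //; have := ler_rsum su s le.
rewrite (rsumD (summZ 2 s1) (summZ 2 s2)) !rsumZ// e1 e2.
by rewrite /energy /wip; under eq_rsum do rewrite expr2; lra.
Qed.

Lemma summ_deg_bounded (S : set X) C u : (forall x, S x -> deg x <= C * mu x) ->
  l2w mu u -> (forall x, ~ S x -> u x = 0) ->
  summ (fun x => u x ^+ 2 * deg x) /\
  rsum (fun x => u x ^+ 2 * deg x) <= C * wip mu u u.
Proof.
move=> HS su uS.
have le x : u x ^+ 2 * deg x <= C * (u x ^+ 2 * mu x).
  have [Sx|/uS->] := pselect (S x); last by rewrite expr0n/= !mul0r mulr0.
  by rewrite mulrCA ler_wpM2l ?sqr_ge0// HS.
have s : summ (fun x => u x ^+ 2 * deg x).
  apply: summ_le (summZ C su) => x.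
  by rewrite ger0_norm// mulr_ge0 ?sqr_ge0// deg_ge0.
split => //; rewrite /wip -rsumZ; last exact: su.
by apply: ler_rsum => //; exact: summZ.
Qed.

(** * Finitely supported functions and the form domain D(Q) *)

Lemma Cc_seq u : Cc u -> exists2 s : seq X, uniq s & forall x, x \notin s -> u x = 0.
Proof.
move=> /finite_seqP[s sE]; exists (undup s); first exact: undup_uniq.
move=> x; rewrite mem_undup => xs; apply/eqP/negPn/negP => ux.
by move/seteqP: sE => [+ _] => /(_ x ux); apply/negP.
Qed.

Lemma Cc_summ u (F : X -> R) : Cc u -> (forall x, u x = 0 -> F x = 0) -> summ F.
Proof. by move=> /Cc_seq[s us us0] H; apply: (@summ_seq _ _ _ s) => x /us0 /H. Qed.

Lemma seq_Cc u (s : seq X) : (forall x, x \notin s -> u x = 0) -> Cc u.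
Proof.
move=> H; apply: (@sub_finite_set _ _ [set` s]); last exact: finite_seq.
move=> x /= ux; apply/negPn/negP => /H u0; by rewrite u0 eqxx in ux.
Qed.

Lemma Cc_l2w u : Cc u -> l2w mu u.
Proof. by move=> cu; apply: (Cc_summ cu) => x ->; rewrite expr0n/= mul0r. Qed.

Lemma Cc_fin_energy u : Cc u -> fin_energy u.
Proof.
move=> cu; have [] // := @fin_energy_deg u; apply: (Cc_summ cu) => x ->.
by rewrite expr0n/= mul0r.
Qed.

Lemma Cc_lin c u v : Cc u -> Cc v -> Cc (fun x => u x + c * v x).
Proof.
move=> /Cc_seq[s _ us] /Cc_seq[r _ vr]; apply: (@seq_Cc _ (s ++ r)) => x.
by rewrite mem_cat negb_or => /andP[/us -> /vr ->]; rewrite mulr0 addr0.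
Qed.

Lemma DQP f : DQ G f <-> [/\ l2w mu f, fin_energy f &
  forall e : R, 0 < e -> exists2 g, Cc g & sqnormQ (fun x => f x - g x) < e].
Proof.
have nl g e : l2w mu f -> fin_energy f -> Cc g -> 0 < e ->
    (normQ G (f \- g)%R < e%:E)%E = (sqnormQ (fun x => f x - g x) < e ^+ 2).
  move=> sf ef cg e0; rewrite -normQ_lt//.
    by apply: l2wB => //; exact: Cc_l2w.
  by apply: fin_energyB => //; exact: Cc_fin_energy.
split.
  move=> [/DQmaxP[sf ef] H]; split=> // e e0.
  have [|g cg] := H (Num.sqrt e); first by rewrite sqrtr_gt0.
  rewrite nl// ?sqrtr_gt0// sqr_sqrtr ?ltW// => ?.
  by exists g.
move=> [sf ef H]; split; first exact/DQmaxP.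
move=> e e0; have [|g cg fg] := H (e ^+ 2); first by rewrite exprn_gt0.
by exists g => //; rewrite nl.
Qed.

Lemma Cc_DQ u : Cc u -> DQ G u.
Proof.
move=> cu; apply/DQP; split; [exact: Cc_l2w|exact: Cc_fin_energy|move=> e e0].
exists u => //; rewrite /sqnormQ /energy /wip.
rewrite (@eq_rsum _ _ _ (fun=> 0)) ?rsum0; last first.
  by move=> p; rewrite /grad; ring.
rewrite (@eq_rsum _ _ _ (fun=> 0)) ?rsum0; last by move=> p; ring.
by rewrite mulr0 addr0.
Qed.

Lemma DQ_closed f : l2w mu f -> fin_energy f ->
  (forall e : R, 0 < e -> exists2 g, DQ G g & sqnormQ (fun x => f x - g x) < e) ->
  DQ G f.
Proof.
move=> sf ef H; apply/DQP; split=> // e e0.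
(* Two approximations, each doubled by [sqnormQD_le], must add up to e. *)
have e4 : 0 < e / 4 by rewrite divr_gt0.
have [g /DQP[sg eg Hg] fg] := H _ e4.
have [h ch gh] := Hg _ e4; exists h => //.
have := sqnormQD_le (l2wB mu_ge0 sf sg) (fin_energyB ef eg)
  (l2wB mu_ge0 sg (Cc_l2w ch)) (fin_energyB eg (Cc_fin_energy ch)).
rewrite (_ : (fun x => _ + _) = (fun x => f x - h x)); last first.
  by apply/funext => x; ring.
by lra.
Qed.

Lemma l2w_tail u e : l2w mu u -> 0 < e -> exists2 s : seq X, uniq s &
  wip mu (fun x => if x \in s then 0 else u x) (fun x => if x \in s then 0 else u x) < e.
Proof.
move=> su e0; have [s us H] := rsum_tail su e0; exists s => //.
apply: le_lt_trans H; rewrite le_eqVlt; apply/orP; left; apply/eqP/eq_rsum => x.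
case: ifP => _; first by rewrite !mul0r.
by rewrite ger0_norm ?expr2// mulr_ge0// -expr2 sqr_ge0.
Qed.

(** On functions supported in S the squared form norm is at most 2 |C| + 1 times the squared L^2
    norm, so truncations to finite sets converge in the form norm as well. *)
Lemma bounded_deg_DQ (S : set X) C u : (forall x, S x -> deg x <= C * mu x) ->
  l2w mu u -> (forall x, ~ S x -> u x = 0) -> DQ G u.
Proof.
move=> HS su uS.
have est v : l2w mu v -> (forall x, ~ S x -> v x = 0) ->
    fin_energy v /\ sqnormQ v <= (2 * `|C| + 1) * wip mu v v.
  move=> sv vS; have [s1 s2] := summ_deg_bounded HS sv vS.
  have [ev h] := fin_energy_deg s1; split=> //; rewrite /sqnormQ.
  have := ler_wpM2r (wip_ge0 mu_ge0 v) (ler_norm C).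
  by move: (wip mu v v) (C) (`|C|) (rsum _) s2 h => *; lra.
have [eu _] := est u su uS.
apply/DQP; split=> // e e0.
have c0 : 0 < 2 * `|C| + 1 by have := normr_ge0 C; lra.
have [s us H] := l2w_tail su (divr_gt0 e0 c0).
pose g x := if x \in s then u x else 0.
pose v x := if x \in s then 0 else u x.
exists g; first by apply: (@seq_Cc _ s) => x; rewrite /g => /negPf ->.
have E : (fun x => u x - g x) = v.
  by apply/funext => x; rewrite /g /v; case: ifP => _; rewrite ?subrr ?subr0.
have sv : l2w mu v.
  by apply: (le_l2w mu_ge0 _ su) => x; rewrite /v; case: ifP; rewrite ?normr0.
have [|_] := est v sv; first by move=> x /uS; rewrite /v => ->; case: ifP.
rewrite E => /le_lt_trans; apply.
by rewrite -ltr_pdivlMl// mulrC.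
Qed.

End GraphForms.

(** * Green's formula *)

Section Laplacian.
Variables (R : realType) (X : countType) (G : weighted_graph R X).
Implicit Types (u v f g : X -> R).

Let w := edge_weight G.
Let mu := vertex_measure G.
Let W : X * X -> R := wpair G.

Let mu_gt0 x : 0 < mu x. Proof. exact: vertex_measure_gt0. Qed.
Let mu_ge0 x : 0 <= mu x. Proof. exact/ltW/mu_gt0. Qed.
Let w_ge0 x y : 0 <= w x y. Proof. exact: edge_weight_ge0. Qed.
Let wC x y : w x y = w y x. Proof. exact: edge_weight_sym. Qed.
Let W_ge0 p : 0 <= W p. Proof. exact: w_ge0. Qed.
Let W_swap p : W (p.2, p.1) = W p. Proof. exact: wC. Qed.

Lemma domFP u : domF G u <-> forall x, summ (fun y => w x y * u y).
Proof.
have E x : (fun y => (edge_weight G x y * `|u y|)%:E) =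
    (fun y => (`|w x y * u y|)%:E).
  by apply/funext => y; rewrite normrM (ger0_norm (w_ge0 x y)).
by split => H x; have := H x; rewrite /summ E.
Qed.

Lemma domF_grad u x : domF G u -> summ (fun y => w x y * (u x - u y)).
Proof.
move=> /domFP /(_ x) sx; have := summB (summZ (u x) (summ_weight G x)) sx.
by apply: eq_summ => y; rewrite /w; ring.
Qed.

(** Since |t| <= 1 + t^2, the differences u x - u y along the edges at x are summable against the
    weights; the constant u x is summable too. *)
Lemma fin_energy_domF u : fin_energy G u -> domF G u.
Proof.
move=> eu; apply/domFP => x; have sw := summ_weight G x.
have := summ_slice x eu; rewrite /grad /wpair/= => s1.
have s2 : summ (fun y => w x y * (u x - u y)).
  apply: summ_le (summD sw s1) => y.
  rewrite normrM (ger0_norm (w_ge0 x y)) -/w.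
  rewrite -(real_normK (num_real (u x - u y))).
  have := mulr_ge0 (w_ge0 x y) (sqr_ge0 (`|u x - u y| - 1)).
  have := mulr_ge0 (w_ge0 x y) (normr_ge0 (u x - u y)).
  by rewrite !expr2; nra.
apply: eq_summ (summB (summZ (u x) sw) s2) => y.
by rewrite /w; ring.
Qed.

Lemma Cc_domF u : Cc u -> domF G u.
Proof. by move=> /(Cc_fin_energy G)/fin_energy_domF. Qed.

Lemma LapE u x : Lap G u x * mu x = rsum (fun y => w x y * (u x - u y)).
Proof. by rewrite /Lap mulrC mulVKf// gt_eqF. Qed.

Lemma Lap_lin c u v x : domF G u -> domF G v ->
  Lap G (fun x => u x + c * v x) x = Lap G u x + c * Lap G v x.
Proof.
move=> /(domF_grad x) su /(domF_grad x) sv.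
rewrite /Lap (mulrCA c) -mulrDr -(rsumZ c sv) -(rsumD su (summZ c sv)).
by congr (_ * _); apply: eq_rsum => y; rewrite /w; ring.
Qed.

Lemma domF_lin c u v : domF G u -> domF G v -> domF G (fun x => u x + c * v x).
Proof.
move=> /domFP du /domFP dv; apply/domFP => x.
by apply: eq_summ (summD (du x) (summZ c (dv x))) => y; ring.
Qed.

(** The energy density is W grad u (x,y) v(x) plus its image under exchange of x and y. If one is
    summable, both have the same sum, and summing over y first produces the Laplacian. *)
Lemma green u v : domF G u ->
  summ (fun p => W p * grad u p * v p.1) ->
  summ (fun p => grad u p * grad v p * W p) /\
  energy G u v = wip mu (Lap G u) v.
Proof.
move=> du s1; have s2 := summ_swap s1.
have E p : grad u p * grad v p * W p =
    W p * grad u p * v p.1 + W (p.2, p.1) * grad u (p.2, p.1) * v p.2.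
  by rewrite W_swap /grad/=; ring.
split; first by apply: eq_summ (summD s1 s2) => p; rewrite E.
rewrite /energy /wip (eq_rsum E) rsumD// (rsum_swap s1).
have [_ ->] := rsum_pair s1.
set S := rsum _; rewrite (_ : 2^-1 * (S + S) = S); last by field.
apply: eq_rsum => x.
rewrite mulrAC LapE mulrC -rsumZ; last exact: domF_grad.
by apply: eq_rsum => y; rewrite mulrC.
Qed.

Lemma summ_Cc_weight u v : domF G u -> Cc v ->
  summ (fun p : X * X => W p * u p.2 * v p.1).
Proof.
move=> /domFP du cv.
have s x : summ (fun y => w x y * u y * v x).
  by apply: eq_summ (summZ (v x) (du x)) => y; rewrite mulrC.
apply: (@summ_pair _ _ _ _
    (fun x => rsum (fun y => `|w x y * u y * v x|))) => //.
apply: (Cc_summ cv) => x vx; rewrite -(rsum0 _ X); apply: eq_rsum => y.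
by rewrite vx mulr0 normr0.
Qed.

Lemma summ_Cc_weight1 u v : Cc v -> summ (fun p : X * X => W p * u p.1 * v p.1).
Proof.
move=> cv.
have s : summ (fun x => u x * v x * deg G x).
  by apply: (Cc_summ cv) => x ->; rewrite mulr0 mul0r.
have [+ _] := @summ_wpair1 _ _ G (fun x => u x * v x) s.
by apply: eq_summ => p; rewrite mulrA.
Qed.

(** No finite energy of u is required: for finitely supported v membership of u in F makes the sum
    over pairs absolutely convergent. *)
Lemma green_Cc u v : domF G u -> Cc v -> energy G u v = wip mu (Lap G u) v.
Proof.
move=> du cv; have [] // := @green u v du.
apply: eq_summ (summB (summ_Cc_weight1 u cv) (summ_Cc_weight du cv)) => p.
by rewrite /grad; ring.
Qed.

(** Moves the Laplacian off a test function: Green's formula is applied to the pair in both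
    orders. *)
Lemma green_Cc_sym u v : domF G u -> Cc v ->
  wip mu (Lap G v) u = wip mu (Lap G u) v.
Proof.
move=> du cv; rewrite -(green_Cc du cv) energyC.
have [] // := @green v u; first exact: Cc_domF.
have s1 := summ_Cc_weight1 u cv.
have s2 := summ_swap (summ_Cc_weight du cv).
apply: eq_summ (summB s1 s2) => p.
by rewrite W_swap /grad/=; ring.
Qed.

(** * Point masses as test functions, and Green's formula on D(Q) *)

Definition delta (x : X) : X -> R := fun y => (y == x)%:R.

Lemma Cc_delta x : Cc (delta x).
Proof.
by apply: (@seq_Cc _ _ _ [:: x]) => y; rewrite inE /delta => /negPf ->.
Qed.

Lemma wip_delta u x : wip mu u (delta x) = u x * mu x.
Proof.
rewrite /wip (@rsum_seq _ _ _ [:: x])//.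
  by rewrite big_seq1 /delta eqxx mulr1.
by move=> y; rewrite inE /delta => /negPf ->; rewrite mulr0 mul0r.
Qed.

Lemma eq_of_wip_delta f g : (forall x, wip mu f (delta x) = wip mu g (delta x)) ->
  f = g.
Proof.
move=> H; apply/funext => x; have := H x; rewrite !wip_delta.
by move/(mulIf (lt0r_neq0 (mu_gt0 x))).
Qed.

Lemma green_DQ u v : l2w mu u -> fin_energy G u -> domF G u ->
  l2w mu (Lap G u) -> DQ G v -> energy G u v = wip mu (Lap G u) v.
Proof.
move=> su eu du sLu /DQP[sv ev H].
apply/eqP; rewrite -subr_eq0 -sqrf_eq0 eq_le sqr_ge0 andbT.
(* Both sides agree at a finitely supported g near v. Cauchy-Schwarz bounds the two errors, and (a -
   b)^2 <= 2 (a - c)^2 + 2 (b - c)^2 yields this constant. *)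
apply: (@le0_of_le_eps _ _
  (2 * energy G u u + 2 * wip mu (Lap G u) (Lap G u))) => e e0.
have [g cg vg] := H e e0.
have [sg eg] := (Cc_l2w G cg, Cc_fin_energy G cg).
have sh := l2wB mu_ge0 sv sg; have eh := fin_energyB ev eg.
have h1 := energy_CS eu eh.
have h2 := wip_CS mu_ge0 sLu sh.
have b1 := energy_ge0 G (fun x => v x - g x).
have b2 := wip_ge0 mu_ge0 (fun x => v x - g x).
move: vg; rewrite /sqnormQ -/mu => vg.
pose z x := v x - g x.
have h3 := ler_wpM2l (energy_ge0 G u) (_ : energy G z z <= e).
have h4 := ler_wpM2l (wip_ge0 mu_ge0 (Lap G u)) (_ : wip mu z z <= e).
have {}h3 : energy G u z ^+ 2 <= energy G u u * e.
  by apply: le_trans h1 (h3 _); rewrite /z; lra.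
have {}h4 : wip mu (Lap G u) z ^+ 2 <= wip mu (Lap G u) (Lap G u) * e.
  by apply: le_trans h2 (h4 _); rewrite /z; lra.
rewrite energyBr// (green_Cc du cg) in h3; rewrite wipBr// in h4.
move: h3 h4; set a := energy G u v; set b := wip mu _ v; set c := wip mu _ g.
have := sqr_ge0 ((a - c) + (b - c)).
move: (energy G u u) (wip mu (Lap G u) (Lap G u)) => A B.
by rewrite !expr2; lra.
Qed.

End Laplacian.

(** * Cutoff functions of an intrinsic metric *)

Lemma clamp_lipschitz (R : realDomainType) (a b : R) :
  `|Num.min 1 (Num.max 0 a) - Num.min 1 (Num.max 0 b)| <= `|a - b|.
Proof.
have le (x y : R) : x <= y ->
    0 <= Num.min 1 (Num.max 0 y) - Num.min 1 (Num.max 0 x) <= y - x.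
  move=> xy; case: (leP 0 x) => ?; case: (leP 0 y) => ?.
  - by case: (leP 1 x) => ?; case: (leP 1 y) => ?; apply/andP; split; lra.
  - by case: (leP 1 x) => ?; case: (leP 1 0) => ?; apply/andP; split; lra.
  - by case: (leP 1 0) => ?; case: (leP 1 y) => ?; apply/andP; split; lra.
  - by case: (leP 1 0) => ?; apply/andP; split; lra.
have [/le/andP[h1 h2]|/ltW/le/andP[h1 h2]] := leP a b.
  by rewrite distrC (distrC a) !ger0_norm// (le_trans h1).
by rewrite !ger0_norm// (le_trans h1).
Qed.

Section Cutoff.
Variables (R : realType) (X : countType) (G : weighted_graph R X).
Variable d : X -> X -> R.
Hypothesis d_pseudo_metric : pseudo_metric d.
Hypothesis d_intrinsic : intrinsic G d.
Hypothesis Deg_bounded : forall (x0 : X) (r : R), 0 <= r ->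
  exists C : R, forall x : X,
    comb_nbhd G (dist_ball d r x0) x -> (Deg G x <= C%:E)%E.
Implicit Types (u v f g : X -> R).

Let w := edge_weight G.
Let mu := vertex_measure G.
Let W : X * X -> R := wpair G.

Let mu_gt0 x : 0 < mu x. Proof. exact: vertex_measure_gt0. Qed.
Let mu_ge0 x : 0 <= mu x. Proof. exact/ltW/mu_gt0. Qed.
Let w_ge0 x y : 0 <= w x y. Proof. exact: edge_weight_ge0. Qed.
Let wC x y : w x y = w y x. Proof. exact: edge_weight_sym. Qed.
Let W_ge0 p : 0 <= W p. Proof. exact: w_ge0. Qed.
Let W_swap p : W (p.2, p.1) = W p. Proof. exact: wC. Qed.

Variable x0 : X.

Lemma deg_bounded r : 0 <= r -> exists C : R, forall x,
  comb_nbhd G (dist_ball d r x0) x -> deg G x <= C * mu x.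
Proof.
move=> r0; have [C HC] := Deg_bounded x0 r0; exists C => x /HC.
rewrite /Deg (ge0_esum_rsum _ (summ_weight G x))//.
by rewrite -EFinM lee_fin ler_pdivrMl// mulrC.
Qed.

Lemma intrinsic_rsum x : summ (fun y => w x y * d x y ^+ 2) /\
  rsum (fun y => w x y * d x y ^+ 2) <= mu x.
Proof.
have p0 y : 0 <= w x y * d x y ^+ 2 by rewrite mulr_ge0// sqr_ge0.
have := d_intrinsic x => H.
have s : summ (fun y => w x y * d x y ^+ 2).
  apply/ge0_summ => //; move: H; rewrite -/w; case: (esum _ _) => [r||]//.
    by rewrite ltry.
  by rewrite gt0_muley// lte_fin invr_gt0; exact: mu_gt0.
split=> //; move: H; rewrite (ge0_esum_rsum p0 s) -EFinM lee_fin.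
by rewrite ler_pdivrMl ?mulr1//; exact: mu_gt0.
Qed.

Definition cutoff (n : R) x : R := Num.min 1 (Num.max 0 (2 - d x x0 / n)).

Lemma cutoff_ge0 n x : 0 <= cutoff n x.
Proof. by rewrite /cutoff le_min ler01 le_max lexx. Qed.

Lemma cutoff_le1 n x : cutoff n x <= 1.
Proof. by rewrite /cutoff ge_min lexx. Qed.

Lemma cutoff_eq1 n x : 0 < n -> d x x0 <= n -> cutoff n x = 1.
Proof.
move=> n0 dn; apply/min_idPl; rewrite le_max; apply/orP; right.
have : d x x0 / n <= 1 by rewrite ler_pdivrMr// mul1r.
by lra.
Qed.

Lemma cutoff_eq0 n x : 0 < n -> ~ dist_ball d (2 * n) x0 x -> cutoff n x = 0.
Proof.
rewrite /dist_ball /= => n0 /negP; rewrite -ltNge => dn.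
have h : 2 < d x x0 / n by rewrite ltr_pdivlMr.
by rewrite /cutoff max_l ?min_r//; lra.
Qed.

Lemma cutoff_lipschitz n x y : 0 < n ->
  (cutoff n x - cutoff n y) ^+ 2 <= n ^- 2 * d x y ^+ 2.
Proof.
move=> n0; rewrite -(real_normK (num_real (_ - _))) -exprVn -exprMn.
have d0 := pseudo_metric_ge0 d_pseudo_metric.
have n'0 : 0 <= n^-1 by rewrite invr_ge0 ltW.
rewrite ler_sqr ?nnegrE ?mulr_ge0//.
apply: le_trans (clamp_lipschitz _ _) _.
rewrite (_ : _ - _ = n^-1 * (d y x0 - d x x0)); last by ring.
rewrite normrM (ger0_norm n'0) ler_wpM2l//.
have dC := pseudo_metric_sym d_pseudo_metric.
have h1 := pseudo_metric_triangle d_pseudo_metric x y x0.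
have h2 := pseudo_metric_triangle d_pseudo_metric y x x0.
by rewrite ler_norml (dC y x) in h2 *; apply/andP; split; lra.
Qed.

(** In row x the Lipschitz bound and the intrinsic property bound the sum over y by n^-2 mu(x)
    u(x)^2. *)
Lemma cutoff_energy n u : 0 < n -> l2w mu u ->
  summ (fun p => W p * (cutoff n p.1 - cutoff n p.2) ^+ 2 * u p.1 ^+ 2) /\
  rsum (fun p => W p * (cutoff n p.1 - cutoff n p.2) ^+ 2 * u p.1 ^+ 2) <=
    n ^- 2 * wip mu u u.
Proof.
move=> n0 su; set F := fun p => _.
have F0 p : 0 <= F p.
  by apply: mulr_ge0; rewrite ?sqr_ge0// mulr_ge0 ?sqr_ge0.
have sd x : summ (fun y => n ^- 2 * u x ^+ 2 * (w x y * d x y ^+ 2)).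
  by apply: summZ; have [] := intrinsic_rsum x.
have le x y : F (x, y) <= n ^- 2 * u x ^+ 2 * (w x y * d x y ^+ 2).
  rewrite /F /W /wpair/= -/w.
  have := cutoff_lipschitz x y n0.
  move=> /(ler_wpM2l (w_ge0 x y)) /(ler_wpM2r (sqr_ge0 (u x))).
  by move=> /le_trans; apply; rewrite le_eqVlt; apply/orP; left; apply/eqP; ring.
have sx x : summ (fun y => F (x, y)).
  by apply: summ_le (sd x) => y; rewrite ger0_norm.
have lex x : rsum (fun y => F (x, y)) <= n ^- 2 * (u x ^+ 2 * mu x).
  apply: le_trans (ler_rsum (sx x) (sd x) (le x)) _.
  have [s h] := intrinsic_rsum x; rewrite rsumZ// (mulrA _ _ (mu x)) ler_wpM2l//.
  by rewrite mulr_ge0 ?sqr_ge0// invr_ge0 exprn_ge0// ltW.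
have sm := summZ (n ^- 2) su.
have sF : summ F.
  apply: (@summ_pair _ _ _ _ (fun x => n ^- 2 * (u x ^+ 2 * mu x))) => // x.
  by rewrite (eq_rsum (fun y => ger0_norm (F0 (x, y)))).
split=> //; have [s1 ->] := rsum_pair sF.
apply: le_trans (ler_rsum s1 sm lex) _.
by rewrite rsumZ.
Qed.

Lemma cutoff_energy2 n u : 0 < n -> l2w mu u ->
  summ (fun p => W p * (cutoff n p.1 - cutoff n p.2) ^+ 2 * u p.2 ^+ 2) /\
  rsum (fun p => W p * (cutoff n p.1 - cutoff n p.2) ^+ 2 * u p.2 ^+ 2) <=
    n ^- 2 * wip mu u u.
Proof.
move=> n0 su; have [s h] := cutoff_energy n0 su.
have E : (fun p => W p * (cutoff n p.1 - cutoff n p.2) ^+ 2 * u p.2 ^+ 2) =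
    (fun p => (fun q => W q * (cutoff n q.1 - cutoff n q.2) ^+ 2 * u q.1 ^+ 2)
      (p.2, p.1)).
  by apply/funext => p; rewrite W_swap/= -[in RHS]sqrrN opprB.
by rewrite E (rsum_swap s); split=> //; exact: (summ_swap s).
Qed.

Lemma l2w_cutoff n u : l2w mu u -> l2w mu (fun x => cutoff n x * u x) /\
  wip mu (fun x => cutoff n x * u x) (fun x => cutoff n x * u x) <= wip mu u u.
Proof.
move=> su; have le x : (cutoff n x * u x) ^+ 2 * mu x <= u x ^+ 2 * mu x.
  rewrite ler_wpM2r// exprMn ler_piMl ?sqr_ge0//.
  by rewrite exprn_ile1// ?cutoff_ge0 ?cutoff_le1.
have s : l2w mu (fun x => cutoff n x * u x).
  by apply: summ_le su => x; rewrite ger0_norm// mulr_ge0// sqr_ge0.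
by split=> //; exact: ler_rsum s su le.
Qed.

Lemma cutoff_DQ n u : 0 < n -> l2w mu u -> DQ G (fun x => cutoff n x * u x).
Proof.
move=> n0 su; have [|C HC] := @deg_bounded (2 * n).
  by rewrite mulr_ge0// ltW.
have [s _] := l2w_cutoff n su.
apply: (@bounded_deg_DQ _ _ _ (dist_ball d (2 * n) x0) C) => //.
  by move=> x Bx; apply: HC; left.
by move=> x /(cutoff_eq0 n0) ->; rewrite mul0r.
Qed.

(** * Approximation by cutoffs in the form norm *)

Lemma large_radius (s : seq X) (k : R) : exists2 n : R, k <= n &
  forall x, x \in s -> d x x0 <= n.
Proof.
have d0 := pseudo_metric_ge0 d_pseudo_metric.
(* The sum of the distances dominates each of them. *)
exists (`|k| + \sum_(x <- undup s) d x x0).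
  by rewrite (le_trans (ler_norm k))// lerDl sumr_ge0.
move=> x xs; rewrite (bigD1_seq x) ?mem_undup ?undup_uniq//=.
by rewrite addrCA lerDl addr_ge0// sumr_ge0.
Qed.

Lemma DQmax_DQ f : DQmax G f -> DQ G f.
Proof.
move=> /DQmaxP[sf ef]; apply: DQ_closed => // e e0.
(* The L^2 part will cost e / 8 and the energy half of 2 (e / 8) + 2 (e / 8), in all 3 e / 8. *)
have e4 : 0 < e / 8 by rewrite divr_gt0.
have [s us Hs] := rsum_tail ef e4.
have [r ur Hr] := rsum_tail sf e4.
have N0 := wip_ge0 mu_ge0 f.
(* The lower bound gives n >= 1 and n >= 8 |f|^2 / e, hence n^-2 |f|^2 <= e / 8. Only first
   coordinates of the pairs in s have to lie in the ball, by the form of the gradient estimate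
   below. *)
have [n nk Hn] := large_radius (r ++ map fst s) (1 + 8 * wip mu f f / e).
have n1 : 1 <= n.
  by apply: le_trans nk; rewrite lerDl divr_ge0//; [exact: mulr_ge0|exact: ltW].
have n0 : 0 < n by exact: lt_le_trans n1.
have nN : n ^- 2 * wip mu f f <= e / 8.
  rewrite ler_pdivrMl ?exprn_gt0//.
  have : 8 * wip mu f f / e <= n by lra.
  rewrite ler_pdivrMr// => h; have : n * e <= n ^+ 2 * e.
    by apply: ler_wpM2r; [exact: ltW|rewrite expr2 ler_peMl//; exact: ltW].
  by lra.
exists (fun x => cutoff n x * f x); first exact: cutoff_DQ.
have [sc _] := l2w_cutoff n sf.
have [_ ec] : l2w mu (fun x => cutoff n x * f x) /\
    fin_energy G (fun x => cutoff n x * f x) by have /DQP[] := cutoff_DQ n0 sf.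
have c01 x : 0 <= (1 - cutoff n x) ^+ 2 <= 1.
  have c0 := cutoff_ge0 n x; have c1 := cutoff_le1 n x.
  by rewrite sqr_ge0/= exprn_ile1//; lra.
have h1 : wip mu (fun x => f x - cutoff n x * f x)
    (fun x => f x - cutoff n x * f x) <= e / 8.
  apply: le_trans (ltW Hr); apply: ler_rsum.
  - exact: l2w_sq (l2wB mu_ge0 sf sc).
  - by apply: summ_le (summ_norm sf) => x; case: ifP; rewrite ?normr0 ?normr_id.
  move=> x; case: ifP => xr.
    rewrite cutoff_eq1//; first by rewrite mul1r subrr !mul0r.
    by apply: Hn; rewrite mem_cat xr.
  rewrite ger0_norm; last by rewrite mulr_ge0 ?sqr_ge0.
  rewrite ler_wpM2r// -expr2 (_ : _ - _ = (1 - cutoff n x) * f x); last by ring.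
  by rewrite exprMn ler_piMl ?sqr_ge0//; have /andP[] := c01 x.
have [s2 h2] := cutoff_energy2 n0 sf.
set T1 := fun p : X * X => if p \in s then 0 else `|grad f p ^+ 2 * wpair G p|.
have s1 : summ T1.
  by apply: summ_le (summ_norm ef) => p; rewrite /T1; case: ifP; rewrite ?normr0 ?normr_id.
have h3 : wip W (grad (fun x => f x - cutoff n x * f x))
     (grad (fun x => f x - cutoff n x * f x)) <= 2 * (e / 8) + 2 * (e / 8).
  apply: (@le_trans _ _ (rsum (fun p => 2 * T1 p + 2 *
    (W p * (cutoff n p.1 - cutoff n p.2) ^+ 2 * f p.2 ^+ 2)))).
    apply: ler_rsum.
    - exact: l2w_sq (fin_energyB ef ec).
    - by apply: summD; exact: summZ.
    move=> p.
    (* The gradient of (1 - c) f at (x, y) is (1 - c(x)) (f(x) - f(y)) - (c(x) - c(y)) f(y). The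
       first term vanishes for pairs in s; the second is controlled by [cutoff_energy2]. *)
    have le : grad (fun x => f x - cutoff n x * f x) p ^+ 2 <=
        2 * ((1 - cutoff n p.1) ^+ 2 * grad f p ^+ 2) +
        2 * ((cutoff n p.1 - cutoff n p.2) ^+ 2 * f p.2 ^+ 2).
      have := sqr_ge0 ((1 - cutoff n p.1) * grad f p +
        (cutoff n p.1 - cutoff n p.2) * f p.2).
      by rewrite /grad !expr2; lra.
    rewrite -expr2; apply: le_trans (ler_wpM2r (W_ge0 p) le) _.
    rewrite mulrDl lerD//; last first.
      by rewrite le_eqVlt; apply/orP; left; apply/eqP; ring.
    rewrite -mulrA ler_pM2l// /T1; case: ifP => ps.
      rewrite cutoff_eq1//; first by rewrite subrr expr0n/= !mul0r.
      by apply: Hn; rewrite mem_cat; apply/orP; right; apply: map_f.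
    rewrite -mulrA -/W ger0_norm; last by rewrite mulr_ge0 ?sqr_ge0.
    apply: ler_piMl; first by rewrite mulr_ge0 ?sqr_ge0.
    by have /andP[] := c01 p.1.
  rewrite (rsumD (summZ 2 s1) (summZ 2 s2)) !rsumZ//.
  have := le_trans h2 nN; move: Hs; rewrite -/T1.
  by move: (rsum T1) (rsum _) => *; lra.
by rewrite /sqnormQ /energy -/mu -/W; move: h1 h3; move: (wip _ _ _) (wip _ _ _) => *; lra.
Qed.

(** * Finite energy of L^2 functions with Laplacian in L^2 *)

Lemma summ_green_ball r u v : 0 <= r -> l2w mu u -> l2w mu v ->
  (forall x, ~ dist_ball d r x0 x -> v x = 0) ->
  summ (fun p => W p * grad u p * v p.1).
Proof.
move=> r0 su sv vB; have [C HC] := deg_bounded r0.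
set B := dist_ball d r x0 in vB HC.
have key f : l2w mu f -> (forall x, ~ comb_nbhd G B x -> f x = 0) ->
    summ (fun x => f x ^+ 2 * deg G x).
  by move=> sf fB; have [] := summ_deg_bounded HC sf fB.
(* If v(x) and w(x,y) are nonzero, x lies in the ball and y in its combinatorial neighborhood, so u
   may be truncated to that neighborhood, where the degree is bounded. Then |(u(x) - u(y)) v(x)| <=
   u(x)^2 + u(y)^2 + v(x)^2 gives a summable majorant. *)
pose uB x := if `[< comb_nbhd G B x >] then u x else 0.
have suB : l2w mu uB.
  by apply: (le_l2w mu_ge0 _ su) => x; rewrite /uB; case: ifP; rewrite ?normr0.
have [|s1 _] := @summ_wpair1 _ _ G (fun x => uB x ^+ 2).
  by apply: key => // x; rewrite /uB; case: asboolP.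
have [|s2 _] := @summ_wpair2 _ _ G (fun x => uB x ^+ 2).
  by apply: key => // x; rewrite /uB; case: asboolP.
have [|s3 _] := @summ_wpair1 _ _ G (fun x => v x ^+ 2).
  by apply: key => // x nB; apply: vB => Bx; apply: nB; left.
apply: summ_le (summD (summD s1 s2) s3) => p; rewrite -/W.
have [Bp|/vB ->] := pselect (B p.1); last first.
  rewrite mulr0 normr0 expr0n/= mulr0 addr0.
  by rewrite addr_ge0// mulr_ge0// sqr_ge0.
have [->|Wp] := eqVneq (W p) 0; first by rewrite !mul0r normr0 !addr0.
have -> : uB p.1 = u p.1 by rewrite /uB asboolT//; left.
have -> : uB p.2 = u p.2.
  rewrite /uB asboolT//; right; exists p.1 => //.
  by rewrite /adj lt_def -/w wC Wp w_ge0.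
rewrite -!mulrDr -mulrA normrM (ger0_norm (W_ge0 p)) ler_wpM2l//.
rewrite ler_norml /grad; apply/andP; split.
  have := sqr_ge0 (u p.1 + v p.1); have := sqr_ge0 (u p.2 - v p.1).
  have := sqr_ge0 (u p.1); have := sqr_ge0 (u p.2).
  by rewrite !expr2; lra.
have := sqr_ge0 (u p.1 - v p.1); have := sqr_ge0 (u p.2 + v p.1).
have := sqr_ge0 (u p.1); have := sqr_ge0 (u p.2).
by rewrite !expr2; lra.
Qed.

(* Caccioppoli-type estimate, from the pointwise identity
   (u - u')(c^2 u - c'^2 u') = (c u - c' u')^2 - u u' (c - c')^2. *)
Lemma cutoff_energy_le n u : 1 <= n -> l2w mu u -> domF G u ->
  l2w mu (Lap G u) ->
  fin_energy G (fun x => cutoff n x * u x) /\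
  wip W (grad (fun x => cutoff n x * u x)) (grad (fun x => cutoff n x * u x)) <=
    wip mu (Lap G u) (Lap G u) + 2 * wip mu u u.
Proof.
move=> n1 su du sL; have n0 : 0 < n by exact: lt_le_trans n1.
have N0 := wip_ge0 mu_ge0 u.
have [sc hc] := l2w_cutoff n su; have [sv hv] := l2w_cutoff n sc.
set v := (fun x => cutoff n x * (cutoff n x * u x)) in sv hv.
have [|sT1 hT1] := @green _ _ G u v du.
  apply: (@summ_green_ball (2 * n)) => //; first by rewrite mulr_ge0// ltW.
  by move=> x /(cutoff_eq0 n0); rewrite /v => ->; rewrite mul0r.
have [s1 h1] := cutoff_energy n0 su.
have [s2 h2] := cutoff_energy2 n0 su.
have s3 := summD (summZ 2^-1 s1) (summZ 2^-1 s2).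
have le p : grad (fun x => cutoff n x * u x) p ^+ 2 * W p <=
    grad u p * grad v p * W p +
    (2^-1 * (W p * (cutoff n p.1 - cutoff n p.2) ^+ 2 * u p.1 ^+ 2) +
     2^-1 * (W p * (cutoff n p.1 - cutoff n p.2) ^+ 2 * u p.2 ^+ 2)).
  (* This is exactly the slack left by u u' <= (u^2 + u'^2) / 2, up to sign of the correction
     term. *)
  have : 0 <= 2^-1 * (W p * ((cutoff n p.1 - cutoff n p.2) ^+ 2 *
     (u p.1 - u p.2) ^+ 2)).
    apply: mulr_ge0; first by rewrite invr_ge0.
    by apply: mulr_ge0 => //; apply: mulr_ge0; exact: sqr_ge0.
  by rewrite /v /grad !expr2; lra.
have ec : fin_energy G (fun x => cutoff n x * u x).
  apply: summ_le (summD sT1 s3) => p.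
  by rewrite ger0_norm; [exact: le|rewrite mulr_ge0 ?sqr_ge0].
split=> //; apply: le_trans (ler_rsum (l2w_sq ec) (summD sT1 s3) _) _ => //.
rewrite (rsumD sT1 s3) (rsumD (summZ 2^-1 s1) (summZ 2^-1 s2)) !rsumZ//.
have E : rsum (fun p => grad u p * grad v p * wpair G p) = 2 * energy G u v.
  by rewrite /energy /wip; field.
have nle : n ^- 2 * wip mu u u <= wip mu u u.
  by rewrite ler_piMl// invf_le1 ?exprn_gt0// exprn_ege1.
(* Gives 2 <Delta u, v> <= |Delta u|^2 + |v|^2. With |v| <= |u| and n >= 1 the bound no longer
   depends on n. *)
have := wip_ge0 mu_ge0 (fun x => Lap G u x - v x).
rewrite wipBB// E hT1 -/mu; have := le_trans hv hc.
move: (le_trans h1 nle) (le_trans h2 nle).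
by move: (rsum _) (rsum _) (wip mu u u) (wip mu v v) (wip mu (Lap G u) v)
  (wip mu (Lap G u) (Lap G u)) => *; lra.
Qed.

(** A finite partial sum of the energy involves finitely many vertices. For large n the cutoff is 1
    at all of them, so the uniform bound for c_n u applies to u. *)
Lemma Lap_fin_energy u : l2w mu u -> domF G u -> l2w mu (Lap G u) ->
  fin_energy G u.
Proof.
move=> su du sL.
have [] // := @wip_bound _ _ W W_ge0 (grad u)
  (wip mu (Lap G u) (Lap G u) + 2 * wip mu u u).
move=> s us; have [n n1 Hn] := large_radius (map fst s ++ map snd s) 1.
have n0 : 0 < n by exact: lt_le_trans n1.
have [ec hc] := cutoff_energy_le n1 su du sL.
apply: le_trans hc; apply: le_trans (ge0_sum_le_rsum _ (l2w_sq ec) us); last first.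
  by move=> p; rewrite -expr2 mulr_ge0 ?sqr_ge0//; exact: W_ge0.
rewrite !big_seq; apply: ler_sum => p ps; rewrite -expr2 /grad !cutoff_eq1 ?mul1r//.
  by apply: Hn; rewrite mem_cat map_f// orbT.
by apply: Hn; rewrite mem_cat map_f.
Qed.

End Cutoff.

(** * The Laplacian on its maximal domain *)

Section MaximalDomain.
Variables (R : realType) (X : countType) (G : weighted_graph R X).
Implicit Types (u v f g : X -> R).

Let mu := vertex_measure G.
Let mu_gt0 x : 0 < mu x. Proof. exact: vertex_measure_gt0. Qed.
Let mu_ge0 x : 0 <= mu x. Proof. exact/ltW/mu_gt0. Qed.

Definition Lap_dom : set (X -> R) :=
  [set u | [/\ L2 G u, domF G u & L2 G (Lap G u)]].

(** Through this inclusion alone the intrinsic metric enters the arguments of the section. *)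
Hypothesis Lap_dom_DQ : forall u, Lap_dom u -> DQ G u.

Lemma Lap_domP u : Lap_dom u <-> [/\ l2w mu u, domF G u & l2w mu (Lap G u)].
Proof.
by rewrite /Lap_dom /=; split=> -[/L2P ? ? /L2P ?]; split=> //; exact/L2P.
Qed.

Lemma Lap_dom_energy u v : Lap_dom u -> DQ G v ->
  energy G u v = wip mu (Lap G u) v.
Proof.
move=> Du Dv; have /DQP[_ eu _] := Lap_dom_DQ Du.
by move/Lap_domP: Du => [su du sL]; exact: green_DQ.
Qed.

Lemma Lap_dom_lin c u v : Lap_dom u -> Lap_dom v ->
  Lap_dom (fun x => u x + c * v x).
Proof.
move=> /Lap_domP[su du sLu] /Lap_domP[sv dv sLv]; apply/Lap_domP; split.
- by apply: l2wD => //; exact: l2wZ.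
- exact: domF_lin.
- apply: eq_l2w (l2wD (g := fun x => c * Lap G v x) mu_ge0 sLu (l2wZ c sLv)) => x.
  by rewrite Lap_lin.
Qed.

(** Testing the form identity against point masses identifies the operator with the formal
    Laplacian. Conversely Green's formula on D(Q) is that form identity. *)
Lemma op_dom_opL : op_dom (opL G) = Lap_dom.
Proof.
apply/seteqP; split=> u; last first.
  move=> Du; have /DQP[_ eu _] := Lap_dom_DQ Du.
  have /Lap_domP[su du sL] := Du.
  exists (Lap G u); split=> //=; [exact: Lap_dom_DQ|exact/L2P|].
  move=> v Dv; have /DQP[_ ev _] := Dv.
  by rewrite Qtilde_bilinE// inner2E Lap_dom_energy.
move=> [f [/= /DQP[su eu _] /L2P sf H]]; have du := fin_energy_domF eu.
suff E : Lap G u = f by apply/Lap_domP; rewrite E.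
apply: (@eq_of_wip_delta _ _ G) => x; have cx := Cc_delta R x.
rewrite -green_Cc// -Qtilde_bilinE//; last exact: Cc_fin_energy.
by rewrite H//; exact: Cc_DQ.
Qed.

(** * Finitely supported functions as a core; essential self-adjointness *)

Hypothesis Lap_Cc : forall u, Cc u -> L2 G (Lap G u).

Lemma Cc_Lap_dom u : Cc u -> Lap_dom u.
Proof.
by move=> cu; split; [apply/L2P/Cc_l2w|exact: Cc_domF|exact: Lap_Cc].
Qed.

(** For y different from x, w(x,y) is -mu(y) times the Laplacian of the point mass at x, evaluated
    at y. So the sum of w(x,y) |v(y)| is dominated by the product of two L^2 functions. *)
Lemma l2w_domF v : l2w mu v -> domF G v.
Proof.
move=> sv; apply/domFP => x.
have /L2P sL := Lap_Cc (Cc_delta R x).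
apply: summ_le (summ_norm (summ_wip mu_ge0 sL sv)) => y.
have [->|yx] := eqVneq y x.
  by rewrite edge_weight_diag mul0r normr0 normr_ge0.
rewrite mulrAC LapE (@rsum_seq _ _ _ [:: x])//; last first.
  by move=> z; rewrite inE /delta (negPf yx) => /negPf ->; rewrite subrr mulr0.
rewrite big_seq1 /delta (negPf yx) eqxx sub0r mulrN1 mulNr !normrN.
by rewrite edge_weight_sym.
Qed.

Lemma Cc_dense u e : l2w mu u -> 0 < e -> exists2 v, Cc v &
  wip mu (fun x => u x - v x) (fun x => u x - v x) < e.
Proof.
move=> su e0; have [s us H] := l2w_tail su e0.
exists (fun x => if x \in s then u x else 0).
  by apply: (@seq_Cc _ _ _ s) => x /negPf ->.
by rewrite (eq_wip _ (h := fun x => if x \in s then 0 else u x)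
  (k := fun x => if x \in s then 0 else u x))// => x; case: ifP; rewrite ?subrr ?subr0.
Qed.

Lemma Lap_add1_dense f e : l2w mu f -> 0 < e -> exists2 u, Cc u &
  wip mu (fun x => f x - (Lap G u x + u x)) (fun x => f x - (Lap G u x + u x)) < e.
Proof.
move=> sf e0.
pose V := [set v | exists2 u, Cc u & v = (fun x => Lap G u x + u x)].
suff [_ [u cu ->] H] : exists2 v, V v &
    wip mu (fun x => f x - v x) (fun x => f x - v x) < e.
  by exists u.
apply: dense_of_orthogonal => //.
- by exists (fun x => Lap G (fun=> 0) x + 0), (fun=> 0) => //; apply: (@seq_Cc _ _ _ [::]).
- move=> _ [u cu ->]; apply: l2wD => //; last exact: Cc_l2w.
  exact/L2P/Lap_Cc.
- move=> c _ _ [u cu ->] [v cv ->].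
  exists (fun x => u x + c * v x); first exact: Cc_lin.
  apply/funext => x; rewrite Lap_lin; [|exact: Cc_domF..].
  by ring.
- move=> z sz Vz; have dz := l2w_domF sz.
  have E : Lap G z = (fun x => - z x).
    apply: (@eq_of_wip_delta _ _ G) => x; have cx := Cc_delta R x.
    have sx := Cc_l2w G cx; have /L2P sLx := Lap_Cc cx.
    have := Vz _ (ex_intro2 _ _ _ cx erefl).
    rewrite wipDr// wipC -/mu (green_Cc_sym dz cx) => /eqP.
    rewrite addr_eq0 => /eqP ->; rewrite !wip_delta mulNr //.
  (* Now z lies in D(Q) and may serve as its own test function. *)
  have Dz : Lap_dom z by apply/Lap_domP; rewrite E; split=> //; exact: l2wN.
  have := Lap_dom_energy Dz (Lap_dom_DQ Dz); rewrite E.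
  have h1 := energy_ge0 G z; have h2 := wip_ge0 mu_ge0 z.
  rewrite (_ : wip mu _ z = - wip mu z z); last first.
    rewrite -rsumN; last exact: summ_wip.
    by apply: eq_rsum => x; ring.
  by move=> h3; apply: (wip_eq0 mu_ge0) => //; lra.
Qed.

(** Pairing with point masses passes to limits, so the closure acts as the Laplacian. Conversely,
    approximating (Delta + 1) u by (Delta + 1) v controls both u - v and Delta (u - v). *)
Lemma op_closure_opLc :
  op_closure G (opLc G) = [set uf | Lap_dom uf.1 /\ uf.2 = Lap G uf.1].
Proof.
apply/seteqP; split=> -[u f] /=.
  move=> [/= /L2P su /L2P sf H]; have du := l2w_domF su.
  suff E : f = Lap G u by split=> //; apply/Lap_domP; rewrite -E.
  apply: (@eq_of_wip_delta _ _ G) => x; have cx := Cc_delta R x.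
  have sx := Cc_l2w G cx; have /L2P sLx := Lap_Cc cx.
  apply/eqP; rewrite -subr_eq0 -sqrf_eq0 eq_le sqr_ge0 andbT.
  (* The pairings of f with the point mass and of u with its Laplacian are compared with those of an
     approximating pair, for which they coincide; the two Cauchy-Schwarz errors give this
     constant. *)
  apply: (@le0_of_le_eps _ _ (2 * wip mu (delta R x) (delta R x) +
    2 * wip mu (Lap G (delta R x)) (Lap G (delta R x)))) => e e0.
  have [|v [_ [[/= cv ->]]]] := H (Num.sqrt e); first by rewrite sqrtr_gt0.
  have sv := Cc_l2w G cv; have /L2P sLv := Lap_Cc cv.
  have suv := l2wB mu_ge0 su sv; have sfv := l2wB mu_ge0 sf sLv.
  rewrite (norm2_lt suv) ?sqrtr_gt0// (norm2_lt sfv) ?sqrtr_gt0//.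
  rewrite (sqr_sqrtr (ltW e0)) => huv hfv.
  have h1 := wip_CS mu_ge0 sfv sx; have h2 := wip_CS mu_ge0 suv sLx.
  have {}h1 := le_trans h1 (ler_wpM2r (wip_ge0 mu_ge0 _) (ltW hfv)).
  have {}h2 := le_trans h2 (ler_wpM2r (wip_ge0 mu_ge0 _) (ltW huv)).
  rewrite wipBl// -/mu in h1; rewrite wipBl// -/mu in h2.
  move: h1 h2; rewrite -(green_Cc_sym du cx) -(green_Cc_sym (Cc_domF G cv) cx).
  rewrite -/mu (wipC mu u) (wipC mu v).
  move: (wip _ _ _) (wip _ _ _) (wip _ _ _) (wip _ _ _) (wip _ _ _) => a b c k l h1 h2.
  have := sqr_ge0 ((l - k) + (b - k)).
  by rewrite !expr2 in h1 h2 *; lra.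
move=> [Du ->]; have /Lap_domP[su du sL] := Du; split=> /=; [exact/L2P|exact/L2P|].
move=> e e0.
have [|v cv H] := @Lap_add1_dense _ (e ^+ 2) (l2wD mu_ge0 sL su).
  by rewrite exprn_gt0.
have Dv := Cc_Lap_dom cv; have /Lap_domP[sv dv sLv] := Dv.
have Dz : Lap_dom (fun x => u x - v x).
  rewrite (_ : (fun x => _) = (fun x => u x + (-1) * v x)); first exact: Lap_dom_lin.
  by apply/funext => x; rewrite mulN1r.
have LE : Lap G (fun x => u x - v x) = (fun x => Lap G u x - Lap G v x).
  rewrite (_ : (fun x => u x - v x) = (fun x => u x + (-1) * v x)).
    by apply/funext => x; rewrite Lap_lin// mulN1r.
  by apply/funext => x; rewrite mulN1r.
have /Lap_domP[sz dz sLz] := Dz.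
(* With z = u - v, the cross term <Delta z, z> in |Delta z + z|^2 is the energy of z, hence
   nonnegative, and both |z|^2 and |Delta z|^2 are below e^2. *)
have := energy_ge0 G (fun x => u x - v x).
rewrite (Lap_dom_energy Dz (Lap_dom_DQ Dz)).
move: H; rewrite (eq_wip _ (h := fun x => Lap G (fun x => u x - v x) x + (u x - v x))
  (k := fun x => Lap G (fun x => u x - v x) x + (u x - v x))); last 2 first.
- by move=> x; rewrite LE; ring.
- by move=> x; rewrite LE; ring.
rewrite wipDD// => h1 h2.
have h3 := wip_ge0 mu_ge0 (fun x => u x - v x).
have h4 := wip_ge0 mu_ge0 (Lap G (fun x => u x - v x)).
exists v, (Lap G v); split=> //.
- by rewrite norm2_lt//; rewrite -/mu; lra.
- rewrite -[X in norm2 G X]/(fun x => Lap G u x - Lap G v x) -LE.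
  by rewrite norm2_lt//; rewrite -/mu; lra.
Qed.

(** The closure is the maximal operator. It is symmetric because the energy is, and testing an
    element of the adjoint against point masses puts it back in the maximal domain. *)
Lemma essentially_self_adjoint_opLc : essentially_self_adjoint G (opLc G).
Proof.
split.
  by move=> [u f] [/= cu ->]; split=> /=; [exact/L2P/Cc_l2w|exact: Lap_Cc].
rewrite /self_adjoint op_closure_opLc; split.
  move=> u /L2P su e e0; have [|v cv uv] := Cc_dense su (_ : 0 < e ^+ 2).
    by rewrite exprn_gt0.
  exists v; first by exists (Lap G v); split=> //=; exact: Cc_Lap_dom.
  by rewrite norm2_lt//; apply: l2wB => //; exact: Cc_l2w.
apply/seteqP; split=> -[v g] /=.
  move=> [Dv ->]; have [sv dv sLv] := Dv; split=> //= u _ [/= Du ->].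
  rewrite !inner2E (wipC _ u) -(Lap_dom_energy Du (Lap_dom_DQ Dv)) energyC.
  exact: Lap_dom_energy (Lap_dom_DQ Du).
move=> [/= /L2P sv /L2P sg H]; have dv := l2w_domF sv.
suff E : g = Lap G v by split=> //; apply/Lap_domP; rewrite -E.
apply: (@eq_of_wip_delta _ _ G) => x; have cx := Cc_delta R x.
have := H (delta R x) _ (conj (Cc_Lap_dom cx) erefl).
by rewrite !inner2E (green_Cc_sym dv cx) (wipC _ (delta R x)) => ->.
Qed.

End MaximalDomain.

Theorem theorem1 (R : realType) (X : countType) (G : weighted_graph R X)
  (d : X -> X -> R) (d_pseudo_metric : pseudo_metric d)
  (d_intrinsic : intrinsic G d)
  (Deg_bounded : forall (x0 : X) (r : R), 0 <= r ->
     exists C : R, forall x : X,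
       comb_nbhd G (dist_ball d r x0) x -> (Deg G x <= C%:E)%E) :
  [/\ DQ G = DQmax G,
      op_dom (opL G) = [set u | [/\ L2 G u, domF G u & L2 G (Lap G u)]]
    & (forall u : X -> R, Cc u -> L2 G (Lap G u)) ->
      essentially_self_adjoint G (opLc G)].
Proof.
(* A center for the balls and cutoffs. *)
have [x0 _] := infinite_setN0 (vertices_infinite G).
have DQE : DQ G = DQmax G.
  apply/seteqP; split; first by move=> f [].
  exact: (DQmax_DQ d_pseudo_metric d_intrinsic Deg_bounded x0).
have LDQ u : Lap_dom G u -> DQ G u.
  move=> /Lap_domP[su du sL]; rewrite DQE; apply/DQmaxP; split=> //.
  exact: (Lap_fin_energy d_pseudo_metric d_intrinsic Deg_bounded x0).
split=> //; first exact: op_dom_opL.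
exact: essentially_self_adjoint_opLc.
Qed.
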